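(* Fix $p\in(0,1)$. There is a constant $C>0$ (depending only on $p$) such that for all positive integers $n,m$, all integers $d\ge2$ and every $\alpha\subseteq K_{n,m}$, $$\mathbb E\big[\mathrm{Sw}(\alpha)\big]\le\left(\frac{C\,|\alpha|^{3/2}\log(d)^{1/2}}{\sqrt d}\right)^{|\alpha|/2},$$ where the expectation is over all latent vectors $(\mathbf x_u)_{u\in L\cup R}$.
   Context: $K_{n,m}$ is the complete bipartite graph with sides $R$, $|R|=n$, and $L$, $|L|=m$; a subgraph $\alpha\subseteq K_{n,m}$ is identified with its set of edges and $|\alpha|$ is the number of edges. The latent vectors $(\mathbf x_u)_{u\in L\cup R}$ are independent with law $\mathcal N(0,\mathbf I_d)$. $\tau=\tau(d,p)$ is defined by $\mathbb P(d^{-1/2}\langle\mathbf x,\mathbf y\rangle\le\tau)=p$ for independent $\mathbf x,\mathbf y\sim\mathcal N(0,\mathbf I_d)$, and $\sigma(\langle\mathbf x,\mathbf y\rangle):=\mathbf 1(d^{-1/2}\langle\mathbf x,\mathbf y\rangle\le\tau)$. The signed weight of $\alpha$ is $\mathrm{Sw}(\alpha):=\prod_{\{u,v\}\in\alpha}(\sigma(\langle\mathbf x_u,\mathbf x_v\rangle)-p)$. Conventions: empty products equal $1$ and $0^0=1$. *)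

(* Defs.v *)
From HB Require Import structures.
From mathcomp Require Import all_boot all_order all_algebra.
From mathcomp Require Import all_classical all_reals all_analysis.

Set Implicit Arguments.
Unset Strict Implicit.
Unset Printing Implicit Defensive.

Import Order.TTheory GRing.Theory Num.Theory.
Import numFieldNormedType.Exports.

Local Open Scope classical_set_scope.
Local Open Scope ring_scope.

(* Vectors of R^d are [d.-tuple R], which carries the
   product (Borel) sigma-algebra. *)

Definition independent_RVs (R : realType) (dO : measure_display)
    (Omega : measurableType dO) (P : probability Omega R)
    (dT : measure_display) (T : measurableType dT) (I : finType)
    (X : I -> {RV P >-> T}) : Prop :=
  forall (J : {set I}) (A : I -> set T),
    (forall i, measurable (A i)) ->
    P (\bigcap_(i in [set` J]) (X i @^-1` A i)) =
      (\prod_(i in J) P (X i @^-1` A i))%E.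

Definition independent_RV2 (R : realType) (dO : measure_display)
    (Omega : measurableType dO) (P : probability Omega R)
    (dT : measure_display) (T : measurableType dT)
    (X Y : {RV P >-> T}) : Prop :=
  forall A B : set T, measurable A -> measurable B ->
    P (X @^-1` A `&` Y @^-1` B) = (P (X @^-1` A) * P (Y @^-1` B))%E.

(* N(0, I_d) is the d-fold product of the law N(0, 1); a measure on R^d is
   determined by its values on measurable boxes. *)
Definition std_gaussian_law (R : realType) (d : nat)
    (mu : set (d.-tuple R) -> \bar R) : Prop :=
  forall A : 'I_d -> set R, (forall i, measurable (A i)) ->
    mu [set x : d.-tuple R | forall i, A i (tnth x i)] =
      (\prod_(i < d) normal_prob 0 1 (A i))%E.

Definition dotp (R : realType) (d : nat) (x y : d.-tuple R) : R :=
  \sum_(i < d) tnth x i * tnth y i.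

(* Reads [tau = tau(d, p)]. The probability involved depends only on d and tau,
   not on the probability space carrying the two vectors. *)
Definition is_threshold (R : realType) (d : nat) (p tau : R) : Prop :=
  forall (dO : measure_display) (Omega : measurableType dO)
    (P : probability Omega R) (x y : {RV P >-> d.-tuple R}),
    std_gaussian_law (distribution P x) ->
    std_gaussian_law (distribution P y) ->
    independent_RV2 x y ->
    P [set w | (Num.sqrt d%:R)^-1 * dotp (x w) (y w) <= tau] = p%:E.

Definition edge_indicator (R : realType) (d : nat) (tau : R)
    (x y : d.-tuple R) : R :=
  ((Num.sqrt d%:R)^-1 * dotp x y <= tau)%R%:R.

(* The vertices of K_{n,m} are the elements of L + R with L = 'I_m, R = 'I_n;
   the pair (u, v) stands for the edge {inl u, inr v}. *)
Definition signed_weight (R : realType) (n m d : nat) (p tau : R)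
    (alpha : {set 'I_m * 'I_n}) (x : 'I_m + 'I_n -> d.-tuple R) : R :=
  \prod_(e in alpha) (edge_indicator tau (x (inl e.1)) (x (inr e.2)) - p).

(* Main.v *)
Require Import Defs.
From HB Require Import structures.
From mathcomp Require Import all_boot all_order all_algebra.
From mathcomp Require Import all_classical all_reals all_analysis.
From mathcomp Require Import measurable_realfun ring lra.

(** Let k be the number of edges.  Given the left vectors, the right vectors are
    independent, so the expectation is the mean, over the left vectors, of a
    product over the right vertices v of the star integrals

      E_y prod_(i in N(v)) (sigma(<x_i, y>) - p),      sum_v |N(v)| = k.

    It is enough to gain a factor of order sqrt eta for each edge, where eta
    measures the distance from the Gram matrix of the x_i / sqrt d to the
    identity, and then to average eta ^ (k / 2).

    Star integrals ([conditional_bound]).  Write the Gram matrix as I + E, with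
    row sums of |E| at most eta <= 1/2.  The vector z_i = <x_i, y> / sqrt d is
    Gaussian with covariance

      I + E = (1 - eta) I + (eta I + E),

    and eta I + E is diagonally dominant, hence an explicit sum of rank one
    matrices c c^T.  So z has the law of sqrt(1 - eta) w + u with w standard and
    u an independent Gaussian vector of covariance eta I + E.  Integrating w
    first decouples the factors, and turns the i-th one into
    Phi((tau - u_i) / sqrt(1 - eta)) - p, which is at most
    4 sqrt eta exp(|u_i| / sqrt eta).  As u has size sqrt eta, the product of
    these exponentials has mean at most (2 e)^s for s factors.

    The identity in law is [laweq_gram]: the law of sum_c g_c c, for independent
    standard normal g_c, depends only on the Gram matrix sum_c c c^T.  Plane
    rotations ([std_normal_rotation]) concentrate one coordinate in a single
    vector c, which the Gram matrix then determines; induct on the coordinates.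

    The constant p is the mean of Phi(tau / r) for r = |x| / sqrt d, and r is
    close to 1, so that Phi tau - p is of order 1 / sqrt d ([threshold_Phi]).

    Average ([stars_le], [gram_mgf], [expectation_weight_le]).  One can take
    eta = k max |E_ij| + 1 / sqrt d, and then

      (sqrt eta)^k <= (k^(3/2) / sqrt d)^(k/2) exp(sqrt(k d) |E_ij| / 2)

    at a maximal entry.  An entry of E has an exponential moment at most
    2 e^(k/2) at this rate, and the sum over the at most k^2 pairs costs a factor
    that is exponential in k.  This needs d to be large compared with k^3;
    otherwise the claimed bound exceeds 1 >= |Sw|. *)

Set Implicit Arguments.
Unset Strict Implicit.
Unset Printing Implicit Defensive.

Import Order.TTheory GRing.Theory Num.Theory.
Import numFieldNormedType.Exports.

Local Open Scope classical_set_scope.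
Local Open Scope ring_scope.

(** * Product laws on tuples *)
Section product_probability.
Context d1 d2 (T1 : measurableType d1) (T2 : measurableType d2) (R : realType).
Variables (P1 : probability T1 R) (P2 : probability T2 R).

Definition product_prob : set (T1 * T2) -> \bar R := (P1 \x P2)%E.

HB.instance Definition _ := Measure.on product_prob.

Let product_prob_setT : product_prob setT = 1%E.
Proof.
rewrite /product_prob -setXTT product_measure1E//.
rewrite -[RHS]mule1; congr (_ * _)%E; exact: probability_setT.
Qed.

HB.instance Definition _ := Measure_isProbability.Build _ _ _ product_prob product_prob_setT.

End product_probability.

Section tuple_cons.
Context d (T : measurableType d).

Definition tcons n (z : T * n.-tuple T) : n.+1.-tuple T := [tuple of z.1 :: z.2].

Lemma measurable_tcons n : measurable_fun setT (@tcons n).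
Proof. exact: measurable_cons. Qed.

HB.instance Definition _ n := isMeasurableFun.Build _ _ _ _ (@tcons n) (@measurable_tcons n).

End tuple_cons.

Section iid.
Context d (T : measurableType d) (R : realType) (mu : probability T R).

(** Built by consing one independent coordinate, so that Tonelli and Fubini for
    the product of two measures peel off the coordinates one at a time. *)
Fixpoint iid n : probability (n.-tuple T) R :=
  match n with
  | 0 => \d_[tuple]
  | n'.+1 => distribution (product_prob mu (iid n')) (@tcons _ T n')
  end.

Lemma iidS n : iid n.+1 = pushforward (mu \x iid n)%E (@tcons _ T n) :> (set _ -> \bar R).
Proof. by []. Qed.

Lemma ge0_integral_iidS n (F : n.+1.-tuple T -> \bar R) :
  measurable_fun setT F -> (forall t, 0 <= F t)%E ->
  (\int[iid n.+1]_t F t = \int[mu]_x \int[iid n]_t F [tuple of x :: t])%E.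
Proof.
move=> mF F0; rewrite ge0_integral_distribution//.
rewrite (@fubini_tonelli1 _ _ _ _ _ mu (iid n) (fun z => F (tcons z)))//.
apply: (measurableT_comp mF); exact: measurable_tcons.
Qed.

Definition box n (A : 'I_n -> set T) : set (n.-tuple T) :=
  [set t | forall i, A i (tnth t i)].

Lemma measurable_box n (A : 'I_n -> set T) :
  (forall i, measurable (A i)) -> measurable (box A).
Proof.
move=> mA.
rewrite (_ : box A = \bigcap_(i in [set: 'I_n]) ((@tnth n T)^~ i @^-1` A i)).
  apply: fin_bigcap_measurable => // i _.
  by rewrite -[X in measurable X]setTI; apply: measurable_tnth.
by apply/seteqP; split=> t /= At i => [_|]; exact: At.
Qed.

Lemma iid_box n (A : 'I_n -> set T) : (forall i, measurable (A i)) ->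
  iid n (box A) = (\prod_(i < n) mu (A i))%E.
Proof.
elim: n A => [|n IHn] A mA.
  by rewrite big_ord0 /= diracE mem_set// => -[].
rewrite big_ord_recl -IHn// iidS /pushforward.
rewrite (_ : _ @^-1` _ = A ord0 `*` box (fun i => A (lift ord0 i))).
  by rewrite product_measure1E//; apply: measurable_box => i; exact: mA.
apply/seteqP; split=> -[x t] /=.
  by move=> At; split; [exact: At ord0|move=> i; have := At (lift ord0 i); rewrite tnthS].
move=> [A0 At] i; case: (unliftP ord0 i) => [j ->|->]; last exact: A0.
by rewrite tnthS; exact: At.
Qed.

(** Boxes form a pi-system that generates the product sigma-algebra. *)
Lemma iid_unique n (nu : {measure set (n.-tuple T) -> \bar R}) :
  (forall A : 'I_n -> set T, (forall i, measurable (A i)) ->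
     nu (box A) = \prod_(i < n) mu (A i))%E ->
  forall B, measurable B -> nu B = iid n B.
Proof.
move=> nuE B mB.
have boxT : box (fun=> setT) = setT :> set (n.-tuple T).
  by apply/seteqP; split.
pose G : set (set (n.-tuple T)) :=
  [set box A | A in [set A : 'I_n -> set T | forall i, measurable (A i)]].
apply: (measure_unique G (fun=> setT)) => //.
- apply/seteqP; split.
    apply: smallest_sub; first exact: smallest_sigma_algebra.
    rewrite -bigcup_seq; apply: bigcup_sub => i _ _ [C mC <-]; apply: sub_sigma_algebra.
    exists (fun j => if j == i then C else setT).
      by move=> j; case: ifP.
    rewrite setTI; apply/seteqP; split=> t /=.
      by move=> /(_ i); rewrite eqxx.
    by move=> Ct j; case: eqP => [->|].
  apply: smallest_sub; first exact: sigma_algebra_measurable.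
  by move=> _ [A mA <-]; exact: measurable_box.
- move=> _ _ [A mA <-] [A' mA' <-]; exists (fun i => A i `&` A' i).
    by move=> i; exact: measurableI.
  by apply/seteqP; split=> t /=; [move=> AA'; split=> i; case: (AA' i)
    |move=> [At A't] i; split].
- by move=> _; exists (fun=> setT).
- by apply/seteqP; split=> // t _; exists 0.
- by move=> _ [A mA <-]; rewrite nuE//; exact/esym/iid_box.
- move=> _; rewrite -boxT nuE//; rewrite big1 ?ltry// => i _.
  exact: probability_setT.
Qed.

End iid.

(** * Integrals of bounded functions *)
Section bounded_measurable.
Context d (T : measurableType d) (R : realType).
Implicit Types (f g : T -> R) (P : probability T R).

(** The signed integrands are all of this kind, and are integrated in R;
    exponentials are unbounded but nonnegative, and are integrated in the extended
    reals. *)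
Definition bmeas f := measurable_fun setT f /\ exists K, forall x, `|f x| <= K.

Lemma bmeas_cst (r : R) : bmeas (fun=> r).
Proof. by split; [exact: measurable_cst|exists `|r|]. Qed.

Lemma bmeasM f g : bmeas f -> bmeas g -> bmeas (fun x => f x * g x).
Proof.
move=> [mf [K fK]] [mg [L gL]]; split; first exact: measurable_funM.
by exists (K * L) => x; rewrite normrM ler_pM.
Qed.

Lemma bmeasB f g : bmeas f -> bmeas g -> bmeas (fun x => f x - g x).
Proof.
move=> [mf [K fK]] [mg [L gL]]; split; first exact: measurable_funB.
by exists (K + L) => x; rewrite (le_trans (ler_normB _ _))// lerD.
Qed.

Lemma bmeas_norm f : bmeas f -> bmeas (fun x => `|f x|).
Proof.
move=> [mf [K fK]]; split; first exact: measurableT_comp.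
by exists K => x; rewrite normr_id.
Qed.

Lemma bmeas_prod (I : eqType) (s : seq I) (Q : pred I) (h : I -> T -> R) :
  (forall i, bmeas (h i)) -> bmeas (fun x => \prod_(i <- s | Q i) h i x).
Proof.
move=> bh; elim: s => [|i s IHs].
  by under eq_fun do rewrite big_nil; exact: bmeas_cst.
under eq_fun do rewrite big_cons.
by case: (Q i) => //; exact: bmeasM.
Qed.

Lemma bmeas_integrable P f : bmeas f -> P.-integrable setT (EFin \o f).
Proof.
move=> [mf [K fK]]; apply: measurable_bounded_integrable => //.
  by apply: le_lt_trans (probability_le1 P measurableT) _; rewrite ltry.
exists K; split; first by rewrite num_real.
by move=> r Kr x _ /=; rewrite (le_trans (fK x))// ltW.
Qed.

Lemma bmeas_EFin_Rintegral P f : bmeas f ->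
  (\int[P]_x f x)%:E = (\int[P]_x (f x)%:E)%E.
Proof.
move=> bf; rewrite fineK//; apply: integrable_fin_num => //.
exact: bmeas_integrable.
Qed.

Lemma Rintegral_prob_cst P (r : R) : \int[P]_x r = r.
Proof.
rewrite Rintegral_cst// -[RHS]mulr1; congr (_ * _).
exact: (congr1 fine (probability_setT P)).
Qed.

Lemma le_Rintegral_cst P f (K : R) : bmeas f -> (forall x, `|f x| <= K) ->
  `|\int[P]_x f x| <= K.
Proof.
move=> bf fK; apply: le_trans (le_normr_Rintegral measurableT _) _.
  exact: bmeas_integrable.
rewrite -[leRHS](Rintegral_prob_cst P); apply: le_Rintegral => //.
- by apply: bmeas_integrable; exact: bmeas_norm.
- by apply: bmeas_integrable; exact: bmeas_cst.
Qed.

(** The bridge from the signed integrals to the nonnegative ones. *)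
Lemma bmeas_norm_le P f g : bmeas f -> measurable_fun setT g ->
  (forall x, `|f x| <= g x) ->
  (`|\int[P]_x f x|%:E <= \int[P]_x (g x)%:E)%E.
Proof.
move=> bf mg fg; have [mf _] := bf.
apply: (@le_trans _ _ (\int[P]_x `|f x|%:E)%E).
  rewrite -(bmeas_EFin_Rintegral P (bmeas_norm bf)) lee_fin.
  by apply: le_normr_Rintegral => //; exact: bmeas_integrable.
apply: ge0_le_integral => //.
- by apply/measurable_EFinP; exact: measurableT_comp.
- exact/measurable_EFinP.
- by move=> x _; rewrite lee_fin.
Qed.

End bounded_measurable.

Lemma bmeas_comp d d' (T : measurableType d) (T' : measurableType d')
    (R : realType) (f : T' -> R) (g : T -> T') :
  bmeas f -> measurable_fun setT g -> bmeas (fun x => f (g x)).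
Proof.
move=> [mf [K fK]] mg; split; first exact: (measurableT_comp mf mg).
by exists K.
Qed.

Section bounded_fubini.
Context d1 d2 (T1 : measurableType d1) (T2 : measurableType d2) (R : realType).
Variables (P1 : probability T1 R) (P2 : probability T2 R).

Lemma bmeas_section (f : T1 * T2 -> R) x : bmeas f -> bmeas (fun y => f (x, y)).
Proof. by move=> bf; apply: (bmeas_comp bf); exact: measurable_pair1. Qed.

Lemma bmeas_Rintegral (f : T1 * T2 -> R) :
  bmeas f -> bmeas (fun x => \int[P2]_y f (x, y)).
Proof.
move=> bf; have [mf [K fK]] := bf; split; last first.
  by exists K => x; apply: le_Rintegral_cst => //; exact: bmeas_section.
apply/measurable_EFinP.
rewrite (_ : _ \o _ = fun x => \int[P2]_y (f (x, y))%:E)%E; last first.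
  by apply/funext => x /=; rewrite (bmeas_EFin_Rintegral P2)//; exact: bmeas_section.
apply: (@measurable_fubini_F _ _ _ _ _ P1 P2 (EFin \o f)).
exact: (bmeas_integrable (product_prob P1 P2)).
Qed.

Lemma bmeas_fubini (f : T1 * T2 -> R) : bmeas f ->
  \int[product_prob P1 P2]_z f z = \int[P1]_x \int[P2]_y f (x, y).
Proof.
move=> bf; apply: EFin_inj.
rewrite (bmeas_EFin_Rintegral (product_prob P1 P2))// (bmeas_EFin_Rintegral P1); last exact: bmeas_Rintegral.
rewrite -(integral12_prod_meas1 (f := EFin \o f)); last exact: (bmeas_integrable (product_prob P1 P2)).
apply: eq_integral => x _; rewrite (bmeas_EFin_Rintegral P2)//.
exact: bmeas_section.
Qed.

End bounded_fubini.

Lemma bmeas_distribution d d' (T : measurableType d) (T' : measurableType d')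
    (R : realType) (P : probability T R) (X : {mfun T >-> T'}) (f : T' -> R) :
  bmeas f -> \int[distribution P X]_y f y = \int[P]_x f (X x).
Proof.
move=> bf; have [mf _] := bf; rewrite /Rintegral integral_distribution//.
  exact/measurable_EFinP.
by apply: (bmeas_integrable P (f := f \o X)); exact: bmeas_comp.
Qed.

Section iid_integrals.
Context d (T : measurableType d) (R : realType) (mu : probability T R).

Lemma Rintegral_iidS n (F : n.+1.-tuple T -> R) : bmeas F ->
  \int[iid mu n.+1]_t F t = \int[mu]_x \int[iid mu n]_t F [tuple of x :: t].
Proof.
move=> bF; rewrite bmeas_distribution// (bmeas_fubini _ _ (f := fun z => F (tcons z)))//.
by apply: (bmeas_comp bF); exact: measurable_tcons.
Qed.

Lemma Rintegral_iid0 (F : 0.-tuple T -> R) : bmeas F ->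
  \int[iid mu 0]_t F t = F [tuple].
Proof.
move=> [mF _]; rewrite /Rintegral integral_dirac//; first by rewrite diracT mul1e.
exact/measurable_EFinP.
Qed.

Lemma Rintegral_iid_prod n (f : 'I_n -> T -> R) : (forall i, bmeas (f i)) ->
  \int[iid mu n]_t \prod_(i < n) f i (tnth t i) = \prod_(i < n) \int[mu]_x f i x.
Proof.
elim: n f => [|n IHn] f bf.
  by rewrite Rintegral_iid0 ?big_ord0//; apply: bmeas_prod => -[].
rewrite Rintegral_iidS; last first.
  by apply: bmeas_prod => i; apply: (bmeas_comp (bf i)); exact: measurable_tnth.
rewrite big_ord_recl -IHn//.
under eq_Rintegral => x _.
  under eq_Rintegral => t _.
    rewrite big_ord_recl tnth0.
    under eq_bigr do rewrite tnthS.
    over.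
  rewrite RintegralZl//; last first.
    apply: (bmeas_integrable (iid mu n)) => //; apply: bmeas_prod => i.
    by apply: (bmeas_comp (bf _)); exact: measurable_tnth.
  over.
by rewrite RintegralZr//; exact: bmeas_integrable.
Qed.

Lemma ge0_integral_iid_prod n (f : 'I_n -> T -> R) (c : 'I_n -> R) :
  (forall i, measurable_fun setT (f i)) -> (forall i x, 0 <= f i x) ->
  (forall i, \int[mu]_x (f i x)%:E = (c i)%:E)%E ->
  (\int[iid mu n]_t (\prod_(i < n) f i (tnth t i))%:E = (\prod_(i < n) c i)%:E)%E.
Proof.
elim: n f c => [|n IHn] f c mf f0 fc.
  rewrite integral_dirac//; first by rewrite diracT mul1e !big_ord0.
  by apply/measurable_EFinP/measurable_prod => -[].
rewrite ge0_integral_iidS; last 2 first.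
- apply/measurable_EFinP/measurable_prod => i _.
  by apply: (measurableT_comp (mf i)); exact: measurable_tnth.
- by move=> t; rewrite lee_fin prodr_ge0.
rewrite big_ord_recl.
transitivity (\int[mu]_x ((f ord0 x)%:E * (\prod_(i < n) c (lift ord0 i))%:E))%E.
  apply: eq_integral => x _.
  rewrite -(IHn (fun i => f (lift ord0 i)))//.
  rewrite -ge0_integralZl//; last first.
  - by rewrite lee_fin.
  - by move=> t _; rewrite lee_fin prodr_ge0.
  - apply/measurable_EFinP/measurable_prod => i _.
    by apply: (measurableT_comp (mf _)); exact: measurable_tnth.
  apply: eq_integral => t _; rewrite -EFinM big_ord_recl tnth0.
  by under eq_bigr do rewrite tnthS.
have c0 i : 0 <= c i.
  by rewrite -lee_fin -fc; apply: integral_ge0 => x _; rewrite lee_fin.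
rewrite ge0_integralZr//; first by rewrite fc EFinM.
- exact/measurable_EFinP.
- by move=> x _; rewrite lee_fin.
- by rewrite lee_fin prodr_ge0.
Qed.

Lemma measurable_tcat m n : measurable_fun setT
  (fun z : m.-tuple T * n.-tuple T => [tuple of z.1 ++ z.2]).
Proof.
apply/measurable_fun_tnthP => i; case: (split_ordP i) => j ->.
  rewrite (_ : _ \o _ = fun z : m.-tuple T * n.-tuple T => tnth z.1 j).
    by apply: (measurableT_comp (measurable_tnth j)).
  by apply/funext => -[s t] /=; exact: tnth_lshift.
rewrite (_ : _ \o _ = fun z : m.-tuple T * n.-tuple T => tnth z.2 j).
  by apply: (measurableT_comp (measurable_tnth j)).
by apply/funext => -[s t] /=; exact: tnth_rshift.
Qed.

(** This is what lets the right vectors be integrated before the left ones. *)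
Lemma Rintegral_iid_cat m n (F : (m + n).-tuple T -> R) : bmeas F ->
  \int[iid mu (m + n)]_t F t =
  \int[iid mu m]_s \int[iid mu n]_t F [tuple of s ++ t].
Proof.
move=> bF.
have bcat k (G : (k + n).-tuple T -> R) : bmeas G ->
    bmeas (fun s : k.-tuple T => \int[iid mu n]_t G [tuple of s ++ t]).
  move=> bG; have := bmeas_comp bG (@measurable_tcat k n).
  exact: (bmeas_Rintegral (iid mu k) (iid mu n)).
elim: m F bF => [|m IHm] F bF.
  rewrite Rintegral_iid0; last exact: bcat.
  by apply: eq_Rintegral => t _; congr F; exact: val_inj.
rewrite [RHS]Rintegral_iidS; last exact: bcat.
transitivity (\int[iid mu (m + n).+1]_t (F : (m + n).+1.-tuple T -> R) t) => //.
rewrite Rintegral_iidS//; apply: eq_Rintegral => x _.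
rewrite (IHm (fun t => F [tuple of x :: t])); last first.
  by apply: (bmeas_comp bF); exact: measurable_cons.
apply: eq_Rintegral => s _; apply: eq_Rintegral => t _; congr F; exact: val_inj.
Qed.

End iid_integrals.

(** * The standard normal law and plane rotations *)
Section gaussian_line.
Context (R : realType).
Local Notation lam := (@lebesgue_measure R).

(** A copy of [normal_prob 0 1] on R with its Borel sigma-algebra: the latter
    lives on another measurable structure with the same measurable sets. *)
Definition std_normal : set R -> \bar R := @normal_prob R 0 1.

Let std_normal_semi_sigma_additive : semi_sigma_additive std_normal.
Proof. exact: (@measure_semi_sigma_additive _ _ _ (@normal_prob R 0 1)). Qed.

HB.instance Definition _ := isMeasure.Build _ R R std_normal
  (measure0 (@normal_prob R 0 1)) (measure_ge0 (@normal_prob R 0 1))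
  std_normal_semi_sigma_additive.

HB.instance Definition _ := Measure_isProbability.Build _ R R std_normal
  (probability_setT (@normal_prob R 0 1)).

Lemma ge0_integral_normal (m s : R) (f : R -> \bar R) :
  measurable_fun setT f -> (forall x, 0 <= f x)%E ->
  (\int[normal_prob m s]_x f x = \int[lam]_x (f x * (normal_pdf m s x)%:E))%E.
Proof.
move=> mf f0.
have dom := @normal_prob_dominates R m s.
rewrite -(Radon_Nikodym_SigmaFinite.change_of_variables dom)//.
apply: ae_eq_integral => //.
- apply: emeasurable_funM => //.
  exact: measurable_int (Radon_Nikodym_SigmaFinite.f_integrable dom).
- by apply: emeasurable_funM => //; apply/measurable_EFinP; exact: measurable_normal_pdf.
- apply: ae_eqe_mul2l; apply: integral_ae_eq => //.
  + exact: (Radon_Nikodym_SigmaFinite.f_integrable dom).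
  + by apply/measurable_EFinP; exact: measurable_normal_pdf.
  + by move=> E _ mE; rewrite -(Radon_Nikodym_SigmaFinite.f_integral dom).
Qed.

Lemma ge0_integral_std_normal (f : R -> \bar R) :
  measurable_fun setT f -> (forall x, 0 <= f x)%E ->
  (\int[std_normal]_x f x = \int[lam]_x (f x * (normal_pdf 0 1 x)%:E))%E.
Proof.
move=> mf f0; rewrite -ge0_integral_normal//.
have mid : measurable_fun setT (idfun : measurableTypeR R -> R).
  by move=> _ A mA; rewrite setTI.
exact: (ge0_integral_pushforward mid (@normal_prob R 0 1) measurableT mf).
Qed.

Let integral_affine_pos (a b : R) (f : R -> \bar R) : 0 < a ->
  measurable_fun setT f -> (forall x, 0 <= f x)%E ->
  (\int[lam]_x f x = a%:E * \int[lam]_x f (a * x + b)%R)%E.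
Proof.
move=> a0 mf f0.
have maff : measurable_fun setT (fun x : R => a * x + b).
  by apply: measurable_funD => //; exact: measurable_funM.
pose aff := (fun x : R => a * x + b) : measurableTypeR R -> measurableTypeR R.
have maff' : measurable_fun setT aff by exact: maff.
pose nu0 : {measure set measurableTypeR R -> \bar R} :=
  mscale (NngNum (ltW a0)) (pushforward lam aff).
pose nu := nu0 maff'.
have nuE A : measurable A -> lam A = nu A.
  apply: lebesgue_measure_unique => _ [[u v]] _ <-.
  have -> : nu `]u, v]%classic = (a%:E * lam (aff @^-1` `]u, v]%classic))%E by [].
  rewrite (_ : _ @^-1` _ = `](u - b) / a, (v - b) / a]%classic).
    rewrite !lebesgue_measure_itv/= !lte_fin ltr_pM2r ?invr_gt0// ltrD2r.
    case: ifPn => _; last by rewrite mule0.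
    rewrite -!EFinD -EFinM -mulrBl mulrC divfK ?gt_eqF//.
    by rewrite opprB addrA subrK.
  apply/seteqP; split=> x /=; rewrite !in_itv/= ltr_pdivrMr// ler_pdivlMr//;
    by rewrite ltrBlDr lerBrDr (mulrC x).
transitivity (\int[nu]_x f x)%E.
  by apply: eq_measure_integral => A mA _; exact: nuE.
rewrite ge0_integral_mscale//; congr (_ * _)%E.
by rewrite ge0_integral_pushforward.
Qed.

(** By uniqueness of Lebesgue measure among the measures that give each interval
    its length; a negative slope reduces to a positive one by reflection. *)
Lemma integral_affine (a b : R) (f : R -> \bar R) : a != 0 ->
  measurable_fun setT f -> (forall x, 0 <= f x)%E ->
  (\int[lam]_x f x = `|a|%:E * \int[lam]_x f (a * x + b)%R)%E.
Proof.
move=> a0 mf f0.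
have /orP[a_lt0|a_gt0] : (a < 0) || (0 < a) by rewrite -neq_lt.
  2: by rewrite (integral_affine_pos b a_gt0)// gtr0_norm.
have Na_gt0 : 0 < - a by rewrite oppr_gt0.
rewrite (integral_affine_pos b Na_gt0)// ltr0_norm//.
congr (_ * _)%E.
have maff (c : R) : measurable_fun setT (fun x : R => f (c * x + b)).
  apply: measurableT_comp => //.
  by apply: measurable_funD => //; exact: measurable_funM.
transitivity (\int[lam]_x f (- a * - x + b)%R)%E; last first.
  by apply: eq_integral => x _; rewrite mulrNN.
transitivity (\int[pushforward lam (-%R : _ -> measurableTypeR R)]_x f (- a * x + b)%R)%E.
  by apply: eq_measure_integral => A mA _; exact/esym/lebesgue_measureN.
rewrite ge0_integral_pushforward//; exact: maff.
Qed.

Lemma integral_affineV (a b : R) (f : R -> \bar R) : a != 0 ->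
  measurable_fun setT f -> (forall x, 0 <= f x)%E ->
  (\int[lam]_x f (a * x + b)%R = `|a|^-1%:E * \int[lam]_x f x)%E.
Proof.
move=> a0 mf f0; rewrite (integral_affine b a0 mf f0) muleA -EFinM.
by rewrite mulVf ?normr_eq0// mul1e.
Qed.

(** For c <> 0 the rotation is an affine substitution in x at fixed y, followed by
    one in y at fixed x; their Jacobians 1/|c| and |c| cancel. *)
Let integral2_rot (c s : R) (K : R * R -> \bar R) :
  c != 0 -> c ^+ 2 + s ^+ 2 = 1 ->
  measurable_fun setT K -> (forall z, 0 <= K z)%E ->
  (\int[lam]_x \int[lam]_y K (x, y) =
   \int[lam]_x \int[lam]_y K (c * x - s * y, s * x + c * y)%R)%E.
Proof.
move=> c0 cs mK K0.
have mlin (a b a' b' : R) : measurable_fun setT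
    (fun z : R * R => K (a * z.1 + b * z.2, a' * z.1 + b' * z.2)%R).
  apply: (measurableT_comp mK); apply/measurable_fun_pairP; split => /=;
  by apply: measurable_funD; apply: measurable_funM.
have mrot : measurable_fun setT
    (fun z : R * R => K (c * z.1 - s * z.2, s * z.1 + c * z.2)%R).
  by under eq_fun do rewrite -mulNr; exact: mlin.
have mshear : measurable_fun setT
    (fun z : R * R => K (z.1, c^-1 * z.2 + s / c * z.1)%R).
  have := mlin 1 0 (s / c) c^-1.
  by under eq_fun do rewrite mul1r mul0r addr0 (addrC (s / c * _)).
have mx y : measurable_fun setT (fun x : R => K (x, c^-1 * y + s / c * x)%R).
  exact: (measurableT_comp mshear (measurable_pair2 y)).
have my x : measurable_fun setT (fun y : R => K (x, y)).
  exact: (measurableT_comp mK (measurable_pair1 x)).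
rewrite [RHS](_ : _ = \int[lam]_y \int[lam]_x K (c * x - s * y, s * x + c * y)%R)%E;
  last exact: (fubini_tonelli (m1 := lam) (m2 := lam)
    (fun z : R * R => K (c * z.1 - s * z.2, s * z.1 + c * z.2)%R)).
transitivity (\int[lam]_y (`|c|^-1%:E * \int[lam]_x K (x, c^-1 * y + s / c * x)%R))%E; last first.
  apply: eq_integral => y _.
  rewrite -(integral_affineV (- (s * y)) c0 (mx y))//.
  apply: eq_integral => x _; congr (K (_, _)).
  have -> : c^-1 * y + s / c * (c * x - s * y) =
    s * x + ((c ^+ 2 + s ^+ 2) - s ^+ 2) / c * y by rewrite cs; field.
  by rewrite addrK expr2 mulfK.
rewrite ge0_integralZl//; last 2 first.
- exact: (measurable_fun_fubini_tonelli_G (m1 := lam)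
    (fun z : R * R => K (z.1, c^-1 * z.2 + s / c * z.1)%R)).
- by move=> y _; exact: integral_ge0.
rewrite (_ : \int[lam]_y \int[lam]_x K (x, c^-1 * y + s / c * x)%R =
    \int[lam]_x \int[lam]_y K (x, c^-1 * y + s / c * x)%R)%E;
  last exact/esym/(fubini_tonelli (m1 := lam) (m2 := lam)
    (fun z : R * R => K (z.1, c^-1 * z.2 + s / c * z.1)%R)).
under [X in (_ * X)%E]eq_integral => x _.
  rewrite (integral_affineV (s / c * x) _ (my x))// ?invr_eq0//.
  over.
rewrite ge0_integralZl//; last 2 first.
- exact: (measurable_fun_fubini_tonelli_F (m2 := lam) K).
- by move=> y _; exact: integral_ge0.
by rewrite muleA -EFinM normfV invrK mulVf ?normr_eq0// mul1e.
Qed.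

Definition pdf := @normal_pdf R 0 1.

Lemma pdfE x : pdf x = @normal_peak R 1 * expR (- (x ^+ 2 / 2)).
Proof.
by rewrite /pdf normal_pdfE ?oner_eq0// /normal_fun subr0 expr1n mulNr.
Qed.

Lemma measurable_pdf : measurable_fun setT pdf.
Proof. exact: measurable_normal_pdf. Qed.

Let integral2_std_normal (G : R * R -> \bar R) :
  measurable_fun setT G -> (forall z, 0 <= G z)%E ->
  (\int[std_normal]_x \int[std_normal]_y G (x, y) =
   \int[lam]_x \int[lam]_y (G (x, y) * (pdf x * pdf y)%:E))%E.
Proof.
move=> mG G0.
rewrite ge0_integral_std_normal; last 2 first.
- exact: (measurable_fun_fubini_tonelli_F (m2 := std_normal) G).
- by move=> x; exact: integral_ge0.
apply: eq_integral => x _.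
have mGx : measurable_fun setT (fun y : R => G (x, y)).
  exact: (measurableT_comp mG (measurable_pair1 x)).
rewrite ge0_integral_std_normal// -ge0_integralZr//.
- by apply: eq_integral => y _; rewrite -muleA -EFinM mulrC.
- by apply: emeasurable_funM => //; apply/measurable_EFinP; exact: measurable_pdf.
- by move=> y _; rewrite mule_ge0// lee_fin normal_pdf_ge0.
- by rewrite lee_fin normal_pdf_ge0.
Qed.

(** The density of two independent normals depends only on x^2 + y^2. *)
Lemma std_normal_rotation (c s : R) (G : R * R -> \bar R) :
  c != 0 -> c ^+ 2 + s ^+ 2 = 1 ->
  measurable_fun setT G -> (forall z, 0 <= G z)%E ->
  (\int[std_normal]_x \int[std_normal]_y G (x, y) =
   \int[std_normal]_x \int[std_normal]_y G (c * x - s * y, s * x + c * y)%R)%E.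
Proof.
move=> c0 cs mG G0.
have mlin (a b a' b' : R) : measurable_fun setT
    (fun z : R * R => (a * z.1 + b * z.2, a' * z.1 + b' * z.2)%R).
  apply/measurable_fun_pairP; split => /=;
  by apply: measurable_funD; apply: measurable_funM.
have mrot : measurable_fun setT
    (fun z : R * R => (c * z.1 - s * z.2, s * z.1 + c * z.2)%R).
  by under eq_fun do rewrite -mulNr; exact: mlin.
pose K (z : R * R) := (G z * (pdf z.1 * pdf z.2)%:E)%E.
have mK : measurable_fun setT K.
  apply: emeasurable_funM => //; apply/measurable_EFinP.
  by apply: measurable_funM; apply: (measurableT_comp measurable_pdf).
have K0 z : (0 <= K z)%E.
  by rewrite mule_ge0// lee_fin mulr_ge0// normal_pdf_ge0.
rewrite [LHS](integral2_std_normal mG G0).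
rewrite [LHS](integral2_rot c0 cs mK K0).
rewrite [RHS](integral2_std_normal (measurableT_comp mG mrot) (fun=> G0 _)).
apply: eq_integral => x _; apply: eq_integral => y _.
rewrite /K /=; congr (_ * _%:E)%E.
rewrite !pdfE mulrACA [RHS]mulrACA -!expRD; congr (_ * expR _).
have rot_sqr : (c * x - s * y) ^+ 2 + (s * x + c * y) ^+ 2 = x ^+ 2 + y ^+ 2.
  by rewrite -[RHS]mul1r -cs; ring.
by rewrite -!opprD -!mulrDl rot_sqr.
Qed.

Lemma std_normal_swap (G : R * R -> \bar R) :
  measurable_fun setT G -> (forall z, 0 <= G z)%E ->
  (\int[std_normal]_x \int[std_normal]_y G (x, y) = \int[std_normal]_x \int[std_normal]_y G (y, x))%E.
Proof. by move=> mG G0; exact: (fubini_tonelli (m1 := std_normal) (m2 := std_normal) G). Qed.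

End gaussian_line.

(** * The normal distribution function *)
Section normal_cdf.
Context (R : realType).
Local Notation lam := (@lebesgue_measure R).
Local Notation pdf := (@pdf R).
Local Notation std_normal := (@std_normal R).

(** Completing the square gives the density of the normal law of mean l. *)
Lemma std_normal_mgf (l : R) : (\int[std_normal]_x (expR (l * x))%:E = (expR (l ^+ 2 / 2))%:E)%E.
Proof.
rewrite ge0_integral_std_normal; last 2 first.
- by apply/measurable_EFinP; apply: measurableT_comp => //; exact: measurable_funM.
- by move=> x; rewrite lee_fin expR_ge0.
transitivity (\int[lam]_x ((expR (l ^+ 2 / 2))%:E * (normal_pdf l 1 x)%:E))%E.
  apply: eq_integral => x _; rewrite -!EFinM; congr _%:E.
  rewrite -/pdf pdfE normal_pdfE ?oner_eq0// /normal_fun mulrCA [RHS]mulrCA.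
  by congr (_ * _); rewrite -!expRD; congr expR; rewrite expr1n; field.
rewrite ge0_integralZl//.
- by rewrite integral_normal_pdf mule1.
- by apply/measurable_EFinP; exact: measurable_normal_pdf.
- by move=> x _; rewrite lee_fin normal_pdf_ge0.
Qed.

(** The integrand is a multiple of the density of variance 1 / (1 - t). *)
Lemma std_normal_mgf_sqr (t : R) : t < 1 ->
  (\int[std_normal]_x (expR (t / 2 * x ^+ 2))%:E = ((Num.sqrt (1 - t))^-1)%:E)%E.
Proof.
move=> t1; have t1' : 0 < 1 - t by rewrite subr_gt0.
pose s := (Num.sqrt (1 - t))^-1.
have s0 : 0 < s by rewrite invr_gt0 sqrtr_gt0.
have ss : s ^+ 2 = (1 - t)^-1 by rewrite exprVn sqr_sqrtr// ltW.
have peakE : normal_peak s = s^-1 * @normal_peak R 1.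
  rewrite /normal_peak expr1n mul1r -mulrnAr sqrtrM ?sqr_ge0// sqrtr_sqr.
  by rewrite gtr0_norm// invfM.
rewrite ge0_integral_std_normal; last 2 first.
- apply/measurable_EFinP; apply: measurableT_comp => //.
  by apply: measurable_funM => //; exact: measurable_funX.
- by move=> x; rewrite lee_fin expR_ge0.
transitivity (\int[lam]_x (s%:E * (normal_pdf 0 s x)%:E))%E.
  apply: eq_integral => x _; rewrite -!EFinM; congr _%:E.
  rewrite -/(pdf x) pdfE normal_pdfE ?gt_eqF//= peakE [in RHS]mulrA mulVKf ?gt_eqF//.
  rewrite mulrCA; congr (_ * _); rewrite -expRD; congr expR.
  by rewrite subr0 -mulr_natr ss; field; rewrite gt_eqF.
rewrite ge0_integralZl//.
- by rewrite integral_normal_pdf mule1.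
- by apply/measurable_EFinP; exact: measurable_normal_pdf.
- by move=> x _; rewrite lee_fin normal_pdf_ge0.
- by rewrite lee_fin ltW.
Qed.

Definition Phi (b : R) : R := fine (std_normal `]-oo, b]).

Let pdf_le1 x : pdf x <= 1.
Proof.
have peak1 : @normal_peak R 1 <= 1.
  have sqrt1 : 1 <= Num.sqrt (pi *+ 2) :> R.
    rewrite -[leLHS]sqrtr1 ler_wsqrtr// mulr2n.
    by apply: le_trans (lerD (pi_ge2 R) (pi_ge2 R)); lra.
  by rewrite /normal_peak expr1n mul1r invf_le1// (lt_le_trans ltr01).
have exp1 : expR (- (x ^+ 2 / 2)) <= 1.
  by rewrite -[leRHS]expR0 ler_expR oppr_le0 divr_ge0// sqr_ge0.
by rewrite pdfE -[leRHS]mulr1 ler_pM ?normal_peak_ge0 ?expR_ge0.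
Qed.

(** From |x| <= 1 + x^2/2 <= exp(x^2/2). *)
Let norm_pdf_le1 x : `|x| * pdf x <= 1.
Proof.
have peak1 : @normal_peak R 1 <= 1.
  by have := pdf_le1 0; rewrite pdfE expr0n mul0r oppr0 expR0 mulr1.
have xe : `|x| <= expR (x ^+ 2 / 2).
  apply: le_trans (expR_ge1Dx _).
  have := sqr_ge0 (`|x| - 1); rewrite sqrrB1 real_normK ?num_real// => h.
  by rewrite -mulr_natr in h; lra.
rewrite pdfE mulrCA -[leRHS]mulr1 ler_pM ?normal_peak_ge0 ?mulr_ge0 ?expR_ge0//.
by rewrite expRN -ler_pdivlMr ?invr_gt0 ?expR_gt0// invrK mul1r.
Qed.

Let std_normal_oc_le (a b M : R) : a <= b -> (forall x, a <= x <= b -> pdf x <= M) ->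
  (std_normal `]a, b] <= (M * (b - a))%:E)%E.
Proof.
move=> ab pM; rewrite {1}/std_normal /normal_prob.
have M0 : 0 <= M by apply: le_trans (pM a _); rewrite ?normal_pdf_ge0// lexx.
apply: (@le_trans _ _ (\int[lam]_(x in `]a, b]) M%:E)%E).
  apply: ge0_le_integral => //.
  - by move=> x _; rewrite lee_fin normal_pdf_ge0.
  - by apply/measurable_funTS/measurable_EFinP; exact: measurable_pdf.
  - by move=> x /=; rewrite in_itv/= => /andP[/ltW ax xb]; rewrite lee_fin pM// ax.
rewrite integral_cst//.
have /= := @lebesgue_measure_itv R `]a, b]; rewrite lte_fin => ->.
case: ifPn => _; first by rewrite -EFinD -EFinM.
by rewrite mule0 lee_fin mulr_ge0// subr_ge0.
Qed.

Lemma PhiE b : (Phi b)%:E = std_normal `]-oo, b].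
Proof. by rewrite fineK// fin_num_measure. Qed.

Let Phi_diff (a b M : R) : a <= b -> (forall x, a <= x <= b -> pdf x <= M) ->
  `|Phi b - Phi a| <= M * (b - a).
Proof.
move=> ab pM.
have PhiD : Phi b = Phi a + fine (std_normal `]a, b]).
  rewrite /Phi -fineD ?fin_num_measure//; congr fine.
  rewrite -(measureU std_normal)//.
    congr (std_normal _); apply/seteqP; split=> x /=; rewrite !in_itv/=.
      by case: (leP x a) => xa; [left|right].
    by case=> [/le_trans -> //|/andP[]].
  apply/seteqP; split=> // x [] /=; rewrite !in_itv/= => xa /andP[ax _].
  by move: (lt_le_trans ax xa); rewrite ltxx.
rewrite PhiD addrC addKr ger0_norm ?fine_ge0//.
by rewrite -lee_fin fineK ?fin_num_measure// std_normal_oc_le.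
Qed.

Lemma Phi_lipschitz (a b : R) : `|Phi b - Phi a| <= `|b - a|.
Proof.
wlog ab : a b / a <= b.
  by move=> h; case: (leP a b) => [/h//|/ltW/h]; rewrite distrC (distrC a).
by rewrite [leRHS]ger0_norm ?subr_ge0// -[leRHS]mul1r Phi_diff.
Qed.

(** Between b and s b the density is at most its value at b, and |b| times that
    value is at most 1; this makes the bound uniform in b. *)
Lemma Phi_scale (b s : R) : 1 <= s -> `|Phi (s * b) - Phi b| <= s - 1.
Proof.
move=> s1; have s0 : 0 <= s - 1 by rewrite subr_ge0.
have pdf_mono x : `|b| <= `|x| -> pdf x <= pdf b.
  move=> bx; rewrite !pdfE ler_wpM2l ?normal_peak_ge0// ler_expR lerN2.
  by rewrite ler_pM2r ?invr_gt0// -[leLHS]real_normK ?num_real// -[leRHS]real_normK ?num_real// lerXn2r ?nnegrE.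
apply: (@le_trans _ _ (pdf b * `|s * b - b|)); last first.
  rewrite -[X in _ - X]mul1r -mulrBl normrM (ger0_norm s0) mulrCA.
  by rewrite -[leRHS]mulr1 ler_wpM2l// mulrC norm_pdf_le1.
have [b0|b0] := leP 0 b.
  have bsb : b <= s * b by rewrite -[leLHS]mul1r ler_wpM2r.
  rewrite (ger0_norm (x := s * b - b)) ?subr_ge0//; apply: Phi_diff => // x /andP[bx _].
  by apply: pdf_mono; rewrite !ger0_norm// (le_trans b0).
have sbb : s * b <= b by rewrite -[leRHS]mul1r ler_wnM2r// ltW.
rewrite distrC (distrC (s * b)) (ger0_norm (x := b - s * b)) ?subr_ge0//.
apply: Phi_diff => // x /andP[_ xb].
have x0 : x < 0 by apply: le_lt_trans xb b0.
by apply: pdf_mono; rewrite !ltr0_norm// lerN2.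
Qed.

Lemma Phi_ge0_le1 b : 0 <= Phi b <= 1.
Proof. by rewrite -!lee_fin PhiE measure_ge0 probability_le1. Qed.

End normal_cdf.

(** * The law of a Gaussian vector depends only on its Gram matrix *)
Section gaussian_law.
Context (R : realType) (s : nat).
Local Notation std_normal := (@std_normal R).
Implicit Types (c a b : 'I_s -> R) (cs : seq ('I_s -> R)).

(** The map (t, v) |-> t c + v. *)
Definition axpy c (z : R * s.-tuple R) : s.-tuple R :=
  [tuple z.1 * c i + tnth z.2 i | i < s].

Lemma tnth_axpy c z i : tnth (axpy c z) i = z.1 * c i + tnth z.2 i.
Proof. by rewrite /axpy tnth_mktuple. Qed.

Lemma measurable_axpy c : measurable_fun setT (axpy c).
Proof.
apply/measurable_fun_tnthP => i.
rewrite (_ : _ \o _ = fun z : R * s.-tuple R => z.1 * c i + tnth z.2 i).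
  apply: measurable_funD; first exact: measurable_funM.
  exact: (measurableT_comp (measurable_tnth i)).
by apply/funext => z /=; rewrite tnth_mktuple.
Qed.

HB.instance Definition _ c :=
  isMeasurableFun.Build _ _ _ _ (axpy c) (measurable_axpy c).

Definition tuple0 : s.-tuple R := [tuple 0 | i < s].

(** The law of the sum of g_c c over the vectors c of the list, with independent
    standard normal coefficients g_c. *)
Fixpoint glaw cs : probability (s.-tuple R) R :=
  match cs with
  | [::] => \d_tuple0
  | c :: cs' => distribution (product_prob std_normal (glaw cs')) (axpy c)
  end.

Lemma ge0_integral_glaw_cons c cs (F : s.-tuple R -> \bar R) :
  measurable_fun setT F -> (forall v, 0 <= F v)%E ->
  (\int[glaw (c :: cs)]_v F v =
   \int[std_normal]_t \int[glaw cs]_v F (axpy c (t, v)))%E.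
Proof.
move=> mF F0; rewrite ge0_integral_distribution//.
rewrite (@fubini_tonelli1 _ _ _ _ _ std_normal (glaw cs) (fun z => F (axpy c z)))//.
exact: (measurableT_comp mF (measurable_axpy c)).
Qed.

Lemma ge0_integral_glaw_nil (F : s.-tuple R -> \bar R) :
  measurable_fun setT F -> (\int[glaw [::]]_v F v = F tuple0)%E.
Proof. by move=> mF; rewrite integral_dirac// diracT mul1e. Qed.

Definition laweq cs1 cs2 := forall F : s.-tuple R -> \bar R,
  measurable_fun setT F -> (forall v, 0 <= F v)%E ->
  (\int[glaw cs1]_v F v = \int[glaw cs2]_v F v)%E.

Lemma laweq_cons c cs1 cs2 : laweq cs1 cs2 -> laweq (c :: cs1) (c :: cs2).
Proof.
move=> eq12 F mF F0.
apply: (etrans (ge0_integral_glaw_cons c cs1 mF F0)).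
apply: (etrans _ (esym (ge0_integral_glaw_cons c cs2 mF F0))).
apply: eq_integral => t _; apply: eq12 => //.
exact: (measurableT_comp mF (measurableT_comp (measurable_axpy c) (measurable_pair1 t))).
Qed.

(** The two coefficients that a plane rotation mixes, with the other ones
    integrated out. *)
Let sum2 a b cs (F : s.-tuple R -> \bar R) (z : R * R) : \bar R :=
  (\int[glaw cs]_v F [tuple (z.1 * a i + z.2 * b i) + tnth v i | i < s]%R)%E.

Let measurable_sum2 a b cs F : measurable_fun setT F ->
  (forall v, 0 <= F v)%E -> measurable_fun setT (sum2 a b cs F).
Proof.
move=> mF F0.
have mtup : measurable_fun setT (fun z : (R * R) * s.-tuple R =>
    [tuple (z.1.1 * a i + z.1.2 * b i) + tnth z.2 i | i < s]).
  apply/measurable_fun_tnthP => i.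
  rewrite (_ : _ \o _ = fun z : (R * R) * s.-tuple R =>
    (z.1.1 * a i + z.1.2 * b i) + tnth z.2 i).
    apply: measurable_funD.
      apply: measurable_funD; apply: measurable_funM => //.
        exact: (measurableT_comp measurable_fst).
      exact: (measurableT_comp measurable_snd).
    exact: (measurableT_comp (measurable_tnth i)).
  by apply/funext => z /=; rewrite tnth_mktuple.
exact: (measurable_fun_fubini_tonelli_F (m2 := glaw cs) _
  (measurableT_comp mF mtup) (fun=> F0 _)).
Qed.

Let sum2_ge0 a b cs F z : (forall v, 0 <= F v)%E -> (0 <= sum2 a b cs F z)%E.
Proof. by move=> F0; apply: integral_ge0. Qed.

Let ge0_integral_glaw_cons2 a b cs F : measurable_fun setT F ->
  (forall v, 0 <= F v)%E ->
  (\int[glaw (a :: b :: cs)]_v F v = \int[std_normal]_t \int[std_normal]_u sum2 a b cs F (t, u))%E.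
Proof.
move=> mF F0; rewrite ge0_integral_glaw_cons//; apply: eq_integral => t _.
have mFa : measurable_fun setT (fun v => F (axpy a (t, v))).
  exact: (measurableT_comp mF (measurableT_comp (measurable_axpy a) (measurable_pair1 t))).
rewrite (ge0_integral_glaw_cons b cs mFa (fun=> F0 _)).
apply: eq_integral => u _; apply: eq_integral => v _; congr F.
by apply: eq_from_tnth => i; rewrite !tnth_axpy tnth_mktuple /= addrA.
Qed.

Lemma laweq_swap a b cs : laweq (a :: b :: cs) (b :: a :: cs).
Proof.
move=> F mF F0.
apply: (etrans (ge0_integral_glaw_cons2 a b cs mF F0)).
apply: (etrans _ (esym (ge0_integral_glaw_cons2 b a cs mF F0))).
apply: (etrans (std_normal_swap (measurable_sum2 a b cs mF F0) (fun z => sum2_ge0 a b cs z F0))).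
apply: eq_integral => t _; apply: eq_integral => u _; apply: eq_integral => v _.
by congr F; apply: eq_from_tnth => i; rewrite !tnth_mktuple /= (addrC (u * _)).
Qed.

(** The Givens rotation of angle (x, y) in the plane of the coefficients of a
    and b. *)
Lemma laweq_rotation (x y : R) a b cs : x != 0 -> x ^+ 2 + y ^+ 2 = 1 ->
  laweq (a :: b :: cs)
    ((fun i => x * a i + y * b i) :: (fun i => x * b i - y * a i) :: cs).
Proof.
move=> x0 xy F mF F0.
apply: (etrans (ge0_integral_glaw_cons2 a b cs mF F0)).
apply: (etrans _ (esym (ge0_integral_glaw_cons2 _ _ cs mF F0))).
apply: (etrans (std_normal_rotation x0 xy (measurable_sum2 a b cs mF F0) (fun z => sum2_ge0 a b cs z F0))).
apply: eq_integral => t _; apply: eq_integral => u _; apply: eq_integral => v _.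
by congr F; apply: eq_from_tnth => i; rewrite !tnth_mktuple /=; ring.
Qed.

Definition gram cs (i j : 'I_s) : R := \sum_(c <- cs) c i * c j.

Lemma gram_cons c cs i j : gram (c :: cs) i j = c i * c j + gram cs i j.
Proof. by rewrite /gram big_cons. Qed.

(** Givens rotations, one for each vector of the list, move the whole of the r-th
    row of the Gram matrix into a single vector c. *)
Lemma laweq_concentrate (r : 'I_s) cs : exists c cs',
  [/\ laweq cs (c :: cs'), forall i j, gram cs i j = gram (c :: cs') i j,
      0 <= c r & forall i, gram cs' r i = 0].
Proof.
elim: cs => [|a cs [c0 [cs' [law_cs gram_cs c0r cs'r]]]].
  exists (fun=> 0), [::]; split; last by move=> i; rewrite /gram big_nil.
  - move=> F mF F0; rewrite ge0_integral_glaw_cons// ge0_integral_glaw_nil//.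
    transitivity (\int[std_normal]_t F tuple0)%E.
      by rewrite integral_cst// -[LHS]mule1; congr (_ * _)%E; exact/esym/probability_setT.
    apply: eq_integral => t _.
    rewrite ge0_integral_glaw_nil.
      by congr F; apply: eq_from_tnth => i; rewrite tnth_axpy /= mulr0 add0r.
    exact: (measurableT_comp mF (measurableT_comp (measurable_axpy _) (measurable_pair1 t))).
  - by move=> i j; rewrite gram_cons mul0r add0r.
  - by [].
have law1 : laweq (a :: cs) (a :: c0 :: cs') by exact: laweq_cons.
have gram1 i j : gram (a :: cs) i j = gram (a :: c0 :: cs') i j.
  by rewrite gram_cons gram_cs -gram_cons.
have [ar0|ar0] := eqVneq (a r) 0.
  exists c0, (a :: cs'); split.
  - move=> F mF F0; exact: (etrans (law1 F mF F0) (laweq_swap _ _ _ mF F0)).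
  - by move=> i j; rewrite gram1 !gram_cons addrCA.
  - exact: c0r.
  - by move=> i; rewrite gram_cons ar0 mul0r cs'r addr0.
pose rho := Num.sqrt (a r ^+ 2 + c0 r ^+ 2).
have ssq : 0 < a r ^+ 2 + c0 r ^+ 2.
  by rewrite ltr_wpDr ?sqr_ge0// lt_def sqrf_eq0 ar0 sqr_ge0.
have rho0 : 0 < rho by rewrite sqrtr_gt0.
have rho2 : rho ^+ 2 = a r ^+ 2 + c0 r ^+ 2 by rewrite sqr_sqrtr// ltW.
pose x := a r / rho; pose y := c0 r / rho.
have xy1 : x ^+ 2 + y ^+ 2 = 1.
  by rewrite !expr_div_n -mulrDl -rho2 divff// sqrf_eq0 gt_eqF.
exists (fun i => x * a i + y * c0 i), ((fun i => x * c0 i - y * a i) :: cs').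
split.
- have x0 : x != 0 by rewrite mulf_neq0// invr_eq0 gt_eqF.
  move=> F mF F0; exact: (etrans (law1 F mF F0) (laweq_rotation _ _ _ x0 xy1 mF F0)).
- move=> i j; rewrite gram1 !gram_cons !addrA; congr (_ + _).
  by rewrite -[LHS]mul1r -xy1; ring.
- have -> : x * a r + y * c0 r = rho.
    by rewrite /x /y !(mulrAC _ rho^-1) -mulrDl -!expr2 -rho2 expr2 mulfK ?gt_eqF.
  exact: ltW.
- move=> i; rewrite gram_cons cs'r addr0.
  by rewrite (_ : x * c0 r - y * a r = 0) ?mul0r// /x /y; ring.
Qed.

Lemma glaw_gram0 cs (F : s.-tuple R -> \bar R) :
  measurable_fun setT F -> (forall v, 0 <= F v)%E ->
  (forall i, gram cs i i = 0) -> (\int[glaw cs]_v F v = F tuple0)%E.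
Proof.
elim: cs F => [|c cs IHcs] F mF F0 gcs; first exact: ge0_integral_glaw_nil.
have /all_and2[c0 gcs0] i : c i = 0 /\ gram cs i i = 0.
  have gcs_ge0 : 0 <= gram cs i i by apply: sumr_ge0 => c' _; rewrite -expr2 sqr_ge0.
  have /eqP := gcs i; rewrite gram_cons -expr2 paddr_eq0 ?sqr_ge0// sqrf_eq0.
  by case/andP => /eqP -> /eqP.
apply: (etrans (ge0_integral_glaw_cons c cs mF F0)).
transitivity (\int[std_normal]_t F tuple0)%E.
  apply: eq_integral => t _; rewrite IHcs//.
    by congr F; apply: eq_from_tnth => i; rewrite tnth_axpy c0 mulr0 add0r.
  exact: (measurableT_comp mF (measurableT_comp (measurable_axpy c) (measurable_pair1 t))).
rewrite integral_cst// -[RHS]mule1; congr (_ * _)%E; exact: probability_setT.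
Qed.

(** Concentrating row r in c on both sides, c is determined by the Gram matrix
    (c_r^2 is a diagonal entry, and c_r c_i the r-th row), so the remaining lists
    have equal Gram matrices too, which vanish in one more row. *)
Theorem laweq_gram cs1 cs2 :
  (forall i j, gram cs1 i j = gram cs2 i j) -> laweq cs1 cs2.
Proof.
move=> g12.
suff aux n : (n <= s)%N -> (forall i : 'I_s, (n <= i)%N -> gram cs1 i i = 0) ->
    laweq cs1 cs2.
  by apply: (aux s) => // i; rewrite leqNgt ltn_ord.
elim: n cs1 cs2 g12 => [|n IHn] cs1 cs2 g12 le_ns g0.
  move=> F mF F0; rewrite (glaw_gram0 mF F0 (fun i => g0 i (leq0n i))).
  by rewrite (glaw_gram0 mF F0)// => i; rewrite -g12 g0.
pose r := Ordinal le_ns.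
have [gr0|gr0] := eqVneq (gram cs1 r r) 0.
  apply: IHn => // [|i]; first exact: ltnW.
  rewrite leq_eqVlt => /orP[/eqP ni|]; last exact: g0.
  by have -> : i = r by exact/val_inj.
(* Rows n and above of the remaining Gram matrices vanish: row n by the choice of
   c1 and c2, the others because their diagonal entries are sums of squares. *)
have [c1 [cs1' [law1 gram1 c1r cs1'r]]] := laweq_concentrate r cs1.
have [c2 [cs2' [law2 gram2 c2r cs2'r]]] := laweq_concentrate r cs2.
have gr1 i : gram cs1 r i = c1 r * c1 i by rewrite gram1 gram_cons cs1'r addr0.
have gr2 i : gram cs1 r i = c2 r * c2 i by rewrite g12 gram2 gram_cons cs2'r addr0.
have c12r : c1 r = c2 r.
  by apply/eqP; rewrite -(eqrXn2 (n := 2))// !expr2 -gr1 -gr2.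
have c1r0 : c1 r != 0 by apply: contraNneq gr0 => c10; rewrite gr1 c10 mul0r.
have c12 : c1 = c2.
  by apply/funext => i; apply: (mulfI c1r0); rewrite -gr1 c12r -gr2.
have law12 : laweq (c1 :: cs1') (c2 :: cs2').
  rewrite -c12; apply: laweq_cons; apply: IHn.
  - move=> i j; apply: (addrI (c1 i * c1 j)).
    by rewrite -gram_cons -gram1 g12 gram2 gram_cons c12.
  - exact: ltnW.
  - move=> i; rewrite leq_eqVlt => /orP[/eqP ni|ni].
      by have -> : i = r by exact/val_inj.
    have cs1'_ge0 : 0 <= gram cs1' i i.
      by apply: sumr_ge0 => c' _; rewrite -expr2 sqr_ge0.
    have /eqP := g0 i ni; rewrite gram1 gram_cons -expr2.
    by rewrite paddr_eq0 ?sqr_ge0// => /andP[_ /eqP].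
move=> F mF F0; apply: (etrans (law1 F mF F0)).
exact: (etrans (law12 F mF F0) (esym (law2 F mF F0))).
Qed.

End gaussian_law.

(** * Linear images of Gaussian vectors *)
Section gaussian_law_integrals.
Context (R : realType) (s : nat).
Local Notation std_normal := (@std_normal R).
Implicit Types (c : 'I_s -> R) (cs : seq ('I_s -> R)).

Definition lincomb d (C : 'I_d -> 'I_s -> R) (y : d.-tuple R) : s.-tuple R :=
  [tuple \sum_(j < d) tnth y j * C j i | i < s].

Lemma measurable_lincomb d (C : 'I_d -> 'I_s -> R) :
  measurable_fun setT (lincomb C).
Proof.
apply/measurable_fun_tnthP => i.
rewrite (_ : _ \o _ = fun y => \sum_(j < d) tnth y j * C j i).
  by apply: measurable_sum => j; apply: measurable_funM => //; exact: measurable_tnth.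
by apply/funext => y /=; rewrite tnth_mktuple.
Qed.

Lemma ge0_integral_lincomb d (C : 'I_d -> 'I_s -> R) (F : s.-tuple R -> \bar R) :
  measurable_fun setT F -> (forall v, 0 <= F v)%E ->
  (\int[iid std_normal d]_y F (lincomb C y) = \int[glaw [seq C j | j <- enum 'I_d]]_v F v)%E.
Proof.
elim: d C F => [|d IHd] C F mF F0.
  rewrite (_ : enum 'I_0 = [::]); last by apply: size0nil; rewrite size_enum_ord.
  rewrite ge0_integral_glaw_nil// integral_dirac//; last first.
    exact: (measurableT_comp mF (measurable_lincomb C)).
  rewrite diracT mul1e; congr F; apply: eq_from_tnth => i.
  by rewrite !tnth_mktuple big_ord0.
rewrite enum_ordSl map_cons -map_comp.
apply: (etrans _ (esym (ge0_integral_glaw_cons _ _ mF F0))).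
apply: (etrans (ge0_integral_iidS _ (measurableT_comp mF (measurable_lincomb C)) (fun=> F0 _))).
apply: eq_integral => t _.
have mFt : measurable_fun setT (fun v => F (axpy (C ord0) (t, v))).
  exact: (measurableT_comp mF (measurableT_comp (measurable_axpy _) (measurable_pair1 t))).
rewrite -(IHd (fun j => C (lift ord0 j)) _ mFt (fun=> F0 _)).
apply: eq_integral => y _; congr F; apply: eq_from_tnth => i.
rewrite tnth_axpy !tnth_mktuple big_ord_recl tnth0; congr (_ + _).
by apply: eq_bigr => j _; rewrite tnthS.
Qed.

Definition tadd (z : s.-tuple R * s.-tuple R) : s.-tuple R :=
  [tuple tnth z.1 i + tnth z.2 i | i < s].

Lemma tnth_tadd z i : tnth (tadd z) i = tnth z.1 i + tnth z.2 i.
Proof. by rewrite tnth_mktuple. Qed.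

Lemma measurable_tadd : measurable_fun setT tadd.
Proof.
apply/measurable_fun_tnthP => i.
rewrite (_ : _ \o _ = fun z : s.-tuple R * s.-tuple R => tnth z.1 i + tnth z.2 i).
  by apply: measurable_funD; exact: (measurableT_comp (measurable_tnth i)).
by apply/funext => z /=; rewrite tnth_mktuple.
Qed.

Lemma ge0_integral_glaw_cat cs1 cs2 (F : s.-tuple R -> \bar R) :
  measurable_fun setT F -> (forall v, 0 <= F v)%E ->
  (\int[glaw (cs1 ++ cs2)]_v F v =
   \int[glaw cs1]_u \int[glaw cs2]_w F (tadd (u, w)))%E.
Proof.
move=> mF F0.
have mF2 (G : s.-tuple R -> \bar R) : measurable_fun setT G ->
    (forall v, 0 <= G v)%E -> measurable_fun setT (fun u : s.-tuple R =>
      \int[glaw cs2]_w G (tadd (u, w)))%E.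
  move=> mG G0.
  exact: (measurable_fun_fubini_tonelli_F (m2 := glaw cs2) _
    (measurableT_comp mG measurable_tadd) (fun=> G0 _)).
elim: cs1 F mF F0 => [|c cs1 IHcs] F mF F0.
  rewrite ge0_integral_glaw_nil; last exact: mF2.
  apply: eq_integral => w _; congr F; apply: eq_from_tnth => i.
  by rewrite !tnth_mktuple add0r.
rewrite cat_cons; apply: (etrans (ge0_integral_glaw_cons _ _ mF F0)).
apply: (etrans _ (esym (ge0_integral_glaw_cons _ _ (mF2 F mF F0) _))); last first.
  by move=> u; exact: integral_ge0.
apply: eq_integral => t _.
have mFt : measurable_fun setT (fun v => F (axpy c (t, v))).
  exact: (measurableT_comp mF (measurableT_comp (measurable_axpy _) (measurable_pair1 t))).
rewrite (IHcs _ mFt (fun=> F0 _)).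
apply: eq_integral => u _; apply: eq_integral => w _; congr F.
by apply: eq_from_tnth => i; rewrite tnth_axpy !tnth_tadd tnth_axpy /= addrA.
Qed.

Lemma measurable_expR_dot (th : 'I_s -> R) :
  measurable_fun setT (fun v : s.-tuple R => expR (\sum_(i < s) th i * tnth v i)).
Proof.
apply: measurableT_comp => //; apply: measurable_sum => i.
by apply: measurable_funM => //; exact: measurable_tnth.
Qed.

(** A linear form of the vector is normal, with variance the quadratic form of the
    Gram matrix. *)
Lemma glaw_mgf cs (th : 'I_s -> R) :
  (\int[glaw cs]_v (expR (\sum_(i < s) th i * tnth v i))%:E =
   (expR ((\sum_(c <- cs) (\sum_(i < s) th i * c i) ^+ 2) / 2))%:E)%E.
Proof.
have mE : measurable_fun setT (fun v : s.-tuple R =>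
    (expR (\sum_(i < s) th i * tnth v i))%:E).
  by apply/measurable_EFinP; exact: measurable_expR_dot.
have E0 (v : s.-tuple R) : (0 <= (expR (\sum_(i < s) th i * tnth v i))%:E)%E.
  by rewrite lee_fin expR_ge0.
elim: cs => [|c cs IHcs].
  rewrite ge0_integral_glaw_nil// big_nil mul0r big1// => i _.
  by rewrite tnth_mktuple mulr0.
apply: (etrans (ge0_integral_glaw_cons _ _ mE E0)).
pose l := \sum_(i < s) th i * c i.
transitivity (\int[std_normal]_t ((expR (l * t))%:E *
    (expR ((\sum_(c <- cs) (\sum_(i < s) th i * c i) ^+ 2) / 2))%:E))%E.
  apply: eq_integral => t _; rewrite -IHcs -ge0_integralZl//.
  apply: eq_integral => v _; rewrite -EFinM -expRD; congr (expR _)%:E.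
  rewrite mulr_suml -big_split; apply: eq_bigr => i _.
  by rewrite tnth_axpy /=; ring.
rewrite ge0_integralZr//.
- by rewrite std_normal_mgf -EFinM -expRD big_cons mulrDl.
- by apply/measurable_EFinP; apply: measurableT_comp => //; exact: measurable_funM.
Qed.

End gaussian_law_integrals.

(** A bounded function becomes nonnegative after adding its bound. *)
Lemma bmeas_eq_law d1 d2 d3 (T1 : measurableType d1) (T2 : measurableType d2)
    (T3 : measurableType d3) (R : realType) (P1 : probability T1 R)
    (P2 : probability T2 R) (f1 : T1 -> T3) (f2 : T2 -> T3) :
  measurable_fun setT f1 -> measurable_fun setT f2 ->
  (forall F : T3 -> \bar R, measurable_fun setT F -> (forall x, 0 <= F x)%E ->
     \int[P1]_x F (f1 x) = \int[P2]_x F (f2 x))%E ->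
  forall F : T3 -> R, bmeas F ->
  \int[P1]_x F (f1 x) = \int[P2]_x F (f2 x).
Proof.
move=> mf1 mf2 eq12 F bF; have [mF [K FK]] := bF.
have FK0 x : 0 <= F x - (- K) by have := FK x; rewrite ler_norml; lra.
have bFK : bmeas (fun x => F x - (- K)).
  by apply: bmeasB => //; exact: bmeas_cst.
have shift d (T : measurableType d) (P : probability T R) (f : T -> T3) :
    measurable_fun setT f ->
    \int[P]_x (F (f x) - (- K)) = \int[P]_x F (f x) - (- K).
  move=> mf; rewrite RintegralB//.
  - by congr (_ - _); exact: Rintegral_prob_cst.
  - exact: (bmeas_integrable P (bmeas_comp bF mf)).
  - by apply: bmeas_integrable; exact: bmeas_cst.
apply: (subIr (- K)); rewrite -!shift//; apply: EFin_inj.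
rewrite (bmeas_EFin_Rintegral P1 (bmeas_comp bFK mf1)).
rewrite (bmeas_EFin_Rintegral P2 (bmeas_comp bFK mf2)).
by apply: (eq12 (fun x => (F x - - K)%:E)) => //; apply/measurable_EFinP; case: bFK.
Qed.

(** * Diagonally dominant matrices as Gram matrices *)
Section diagonally_dominant.
Context (R : realType) (s : nat) (E : 'I_s -> 'I_s -> R) (eta : R).
Hypothesis E_sym : forall i j, E i j = E j i.
Hypothesis E_row : forall i, \sum_(j < s) `|E i j| <= eta.

(** |E_ij| / 2 times the square of e_i + sgn(E_ij) e_j contributes E_ij / 2 to each
    of the entries (i, j) and (j, i), and |E_ij| / 2 to the two diagonal ones.
    Summed over all ordered pairs, diagonal ones included, this gives
    E_kl + delta_kl sum_j |E_kj|; the axis vectors then complete the diagonal to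
    eta. *)
Definition pair_column (ij : 'I_s * 'I_s) (k : 'I_s) : R :=
  Num.sqrt (`|E ij.1 ij.2| / 2) *
  ((ij.1 == k)%:R + Num.sg (E ij.1 ij.2) * (ij.2 == k)%:R).

Definition axis_column (a : 'I_s -> R) (i k : 'I_s) : R := a i * (i == k)%:R.

Definition noise_columns : seq ('I_s -> R) :=
  [seq pair_column ij | ij <- enum {: 'I_s * 'I_s}] ++
  [seq axis_column (fun i => Num.sqrt (eta - \sum_(j < s) `|E i j|)) i | i <- enum 'I_s].

Let sum_delta (k : 'I_s) (H : 'I_s -> R) : \sum_(i < s) (i == k)%:R * H i = H k.
Proof.
rewrite (bigD1 k)//= eqxx mul1r big1 ?addr0// => i /negbTE ->.
by rewrite mul0r.
Qed.

Lemma gram_cat (cs1 cs2 : seq ('I_s -> R)) k l :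
  gram (cs1 ++ cs2) k l = gram cs1 k l + gram cs2 k l.
Proof. by rewrite /gram big_cat. Qed.

Lemma gram_axis (a : 'I_s -> R) k l :
  gram [seq axis_column a i | i <- enum 'I_s] k l = a k ^+ 2 * (k == l)%:R.
Proof.
rewrite /gram big_map big_enum /= -(sum_delta k (fun i => a i ^+ 2 * (i == l)%:R)).
by apply: eq_bigr => i _; rewrite /axis_column; ring.
Qed.

Lemma gram_noise k l : gram noise_columns k l = E k l + eta * (k == l)%:R.
Proof.
rewrite /noise_columns gram_cat gram_axis sqr_sqrtr ?subr_ge0//.
suff -> : gram [seq pair_column ij | ij <- enum {: 'I_s * 'I_s}] k l =
  E k l + (\sum_(j < s) `|E k j|) * (k == l)%:R by ring.
rewrite /gram big_map big_enum /=.
transitivity (\sum_(i < s) \sum_(j < s)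
   (((i == k)%:R * ((i == l)%:R * (`|E i j| / 2)) +
     (j == k)%:R * ((j == l)%:R * (`|E i j| / 2))) +
    ((i == k)%:R * ((j == l)%:R * (E i j / 2)) +
     (i == l)%:R * ((j == k)%:R * (E i j / 2))))).
  rewrite pair_bigA; apply: eq_bigr => -[i j] _ /=; rewrite /pair_column /=.
  set e := E i j; set r := Num.sqrt _; set a := _%:R; set b := _%:R.
  set c := _%:R; set d := _%:R.
  have rr : r * r = `|e| / 2 by rewrite -expr2 sqr_sqrtr// divr_ge0.
  have se : Num.sg e * (`|e| / 2) = e / 2 by rewrite mulrA [in RHS](numEsg e).
  have sse : Num.sg e * Num.sg e * (`|e| / 2) = `|e| / 2.
    have [->|e0] := eqVneq e 0; first by rewrite normr0 mul0r mulr0.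
    by rewrite -expr2 sqr_sg e0 mul1r.
  transitivity (a * c * (r * r) + b * d * (Num.sg e * Num.sg e * (r * r)) +
     (a * d * (Num.sg e * (r * r)) + c * b * (Num.sg e * (r * r)))); first by ring.
  by rewrite rr sse se; ring.
have split4 (A B C D : 'I_s -> 'I_s -> R) :
    \sum_(i < s) \sum_(j < s) ((A i j + B i j) + (C i j + D i j)) =
    (\sum_(i < s) \sum_(j < s) A i j + \sum_(i < s) \sum_(j < s) B i j) +
    (\sum_(i < s) \sum_(j < s) C i j + \sum_(i < s) \sum_(j < s) D i j).
  rewrite -!big_split; apply: eq_bigr => i _.
  by rewrite -!big_split; apply: eq_bigr => j _.
rewrite split4.
have -> : \sum_(i < s) \sum_(j < s) (i == k)%:R * ((i == l)%:R * (`|E i j| / 2)) =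
    (k == l)%:R * ((\sum_(j < s) `|E k j|) / 2).
  under eq_bigr do rewrite -mulr_sumr -mulr_sumr.
  by rewrite sum_delta mulr_suml.
have -> : \sum_(i < s) \sum_(j < s) (j == k)%:R * ((j == l)%:R * (`|E i j| / 2)) =
    (k == l)%:R * ((\sum_(j < s) `|E k j|) / 2).
  rewrite exchange_big /=; under eq_bigr do rewrite -mulr_sumr -mulr_sumr.
  by rewrite sum_delta mulr_suml; congr (_ * _); apply: eq_bigr => i _; rewrite E_sym.
have -> : \sum_(i < s) \sum_(j < s) (i == k)%:R * ((j == l)%:R * (E i j / 2)) = E k l / 2.
  under eq_bigr do rewrite -mulr_sumr sum_delta.
  by rewrite sum_delta.
have -> : \sum_(i < s) \sum_(j < s) (i == l)%:R * ((j == k)%:R * (E i j / 2)) = E k l / 2.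
  under eq_bigr do rewrite -mulr_sumr sum_delta.
  by rewrite sum_delta E_sym.
by field.
Qed.

Lemma sum_sqr_gram (cs : seq ('I_s -> R)) (th : 'I_s -> R) :
  \sum_(c <- cs) (\sum_(i < s) th i * c i) ^+ 2 =
  \sum_(i < s) \sum_(j < s) th i * th j * gram cs i j.
Proof.
rewrite /gram; under [RHS]eq_bigr do under eq_bigr do rewrite mulr_sumr.
under [RHS]eq_bigr do rewrite exchange_big /=.
rewrite [RHS]exchange_big /=; apply: eq_bigr => c _.
rewrite expr2 mulr_suml; apply: eq_bigr => i _.
by rewrite mulr_sumr; apply: eq_bigr => j _; ring.
Qed.

Lemma noise_form_le (lam : R) (th : 'I_s -> R) : 0 <= eta -> 0 <= lam ->
  (forall i, `|th i| = lam) ->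
  \sum_(c <- noise_columns) (\sum_(i < s) th i * c i) ^+ 2 <=
  s%:R * (lam ^+ 2 * (eta *+ 2)).
Proof.
move=> eta0 lam0 th_lam; rewrite sum_sqr_gram.
rewrite -[X in X%:R]card_ord mulr_natl -sumr_const; apply: ler_sum => i _.
apply: (@le_trans _ _ (\sum_(j < s) lam ^+ 2 * (`|E i j| + (j == i)%:R * eta))).
  apply: ler_sum => j _; rewrite gram_noise.
  rewrite (le_trans (ler_norm _))// normrM normrM !th_lam -expr2.
  rewrite ler_wpM2l ?sqr_ge0// (le_trans (ler_normD _ _))// lerD2l.
  by rewrite normrM ger0_norm// normr_nat mulrC eq_sym.
by rewrite -mulr_sumr big_split /= sum_delta ler_wpM2l ?sqr_ge0// mulr2n lerD2r.
Qed.

End diagonally_dominant.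

(** * One factor after Gaussian smoothing *)
Section smoothing.
Context (R : realType) (tau p eta : R).
Hypotheses (p01 : 0 <= p <= 1) (eta_gt0 : 0 < eta) (eta_le : eta <= 2^-1).
Hypothesis Phi_p : `|Phi tau - p| <= Num.sqrt eta.
Local Notation std_normal := (@std_normal R).

Definition centered_ind (z : R) : R := (z <= tau)%R%:R - p.

Lemma measurable_centered_ind : measurable_fun setT centered_ind.
Proof.
apply: measurable_funB => //.
rewrite (_ : (fun z => _) = \1_(`]-oo, tau]%classic)); last first.
  by apply/funext => z; rewrite indicE mem_setE in_itv.
exact: measurable_indic.
Qed.

Lemma centered_ind_le1 z : `|centered_ind z| <= 1.
Proof.
rewrite /centered_ind ler_norml; case/andP: p01 => p0 p1.
by case: (z <= tau) => /=; rewrite ?mulr1n ?mulr0n; lra.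
Qed.

Lemma bmeas_centered_ind : bmeas centered_ind.
Proof. by split; [exact: measurable_centered_ind|exists 1; exact: centered_ind_le1]. Qed.

Lemma Rintegral_centered_ind_affine (u a : R) : 0 < a ->
  \int[std_normal]_t centered_ind (u + a * t) = Phi ((tau - u) / a) - p.
Proof.
move=> a0.
have -> : \int[std_normal]_t centered_ind (u + a * t) =
    \int[std_normal]_t (\1_(`]-oo, (tau - u) / a]%classic) t - p).
  apply: eq_Rintegral => t _; rewrite /centered_ind indicE mem_setE in_itv /=.
  by rewrite ler_pdivlMr// lerBrDl mulrC.
rewrite RintegralB//.
- rewrite Rintegral_prob_cst; congr (_ - _).
  by rewrite /Rintegral integral_indic// setIT.
- apply: (bmeas_integrable std_normal (f := \1_(`]-oo, (tau - u) / a]%classic))).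
  split; first exact: measurable_indic.
  by exists 1 => t; rewrite indicE; case: (_ \in _); rewrite ?normr1 ?normr0.
- by apply: bmeas_integrable; exact: bmeas_cst.
Qed.

Let smoothed_indicator_sqrt (a r u : R) : 0 < r -> r ^+ 2 = eta ->
  0 < a -> a ^+ 2 = 1 - eta -> `|Phi tau - p| <= r ->
  `|\int[std_normal]_t centered_ind (u + a * t)| <= 4 * r * expR (`|u| / r).
Proof.
move=> r0 r2 a0 a2 Phi_r.
have a_le1 : a <= 1 by have := eta_gt0; nra.
have a_ge : 2^-1 <= a by have := eta_le; nra.
have r_le1 : r <= 1 by have := eta_le; nra.
have aV : a^-1 <= 2 by rewrite -[leRHS]invrK lef_pV2// posrE invr_gt0.
have aV1 : 1 <= a^-1 by rewrite invf_ge1.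
rewrite Rintegral_centered_ind_affine//.
have step1 : `|Phi ((tau - u) / a) - Phi (tau / a)| <= 2 * `|u|.
  apply: (le_trans (Phi_lipschitz _ _)).
  rewrite -mulrBl addrAC subrr add0r normrM normrN mulrC.
  by rewrite ler_wpM2r// ger0_norm// invr_ge0 ltW.
have step2 : `|Phi (tau / a) - Phi tau| <= 2 * eta.
  rewrite mulrC (le_trans (Phi_scale _ aV1))//.
  have -> : a^-1 - 1 = (1 - a) / a by rewrite mulrBl mul1r divff ?gt_eqF.
  have : 1 - a <= eta by nra.
  have : 0 <= 1 - a by lra.
  by nra.
have tri : `|Phi ((tau - u) / a) - p| <= 2 * `|u| + 2 * eta + r.
  have -> : Phi ((tau - u) / a) - p = (Phi ((tau - u) / a) - Phi (tau / a)) +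
    (Phi (tau / a) - Phi tau) + (Phi tau - p) by ring.
  rewrite (le_trans (ler_normD _ _))// lerD//.
  by rewrite (le_trans (ler_normD _ _))// lerD.
apply: (le_trans tri).
apply: (@le_trans _ _ (4 * r * (1 + `|u| / r))).
  have -> : 4 * r * (1 + `|u| / r) = 4 * r + 4 * `|u| by field; rewrite gt_eqF.
  have := normr_ge0 u; nra.
by rewrite ler_wpM2l ?mulr_ge0 ?expR_ge1Dx// ltW.
Qed.

(** Shifting the threshold by u costs 2|u|, rescaling it by 1 / sqrt(1 - eta) costs
    2 eta, and replacing Phi tau by p costs sqrt eta. *)
Lemma smoothed_indicator_le (u : R) :
  `|\int[std_normal]_t centered_ind (u + Num.sqrt (1 - eta) * t)| <=
  4 * Num.sqrt eta * expR (`|u| / Num.sqrt eta).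
Proof.
have eta1 : 0 < 1 - eta by have := eta_le; lra.
by apply: smoothed_indicator_sqrt; rewrite ?sqrtr_gt0 ?sqr_sqrtr// ltW.
Qed.

(** Exponentials of linear forms in u, so that [glaw_mgf] applies to their
    products. *)
Lemma smoothed_indicator_le2 (u : R) :
  `|\int[std_normal]_t centered_ind (u + Num.sqrt (1 - eta) * t)| <=
  4 * Num.sqrt eta * \sum_(b : bool) expR ((-1) ^+ b / Num.sqrt eta * u).
Proof.
apply: (le_trans (smoothed_indicator_le u)).
rewrite ler_wpM2l ?mulr_ge0 ?sqrtr_ge0// big_bool /= expr1 expr0.
have [u0|u0] := leP 0 u.
  by rewrite ger0_norm// mul1r mulrC ler_wpDl// expR_ge0.
by rewrite ltr0_norm// mulN1r mulNr mulrC mulrN ler_wpDr// expR_ge0.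
Qed.

End smoothing.

(** * The star integral for fixed left vectors *)
Section conditional_bound.
Context (R : realType) (s : nat) (tau p eta : R).
Hypotheses (p01 : 0 <= p <= 1) (eta_gt0 : 0 < eta) (eta_le : eta <= 2^-1).
Hypothesis Phi_p : `|Phi tau - p| <= Num.sqrt eta.
Local Notation std_normal := (@std_normal R).
Local Notation centered_ind := (@centered_ind R tau p).

Definition cprod (v : s.-tuple R) : R := \prod_(i < s) centered_ind (tnth v i).

Lemma bmeas_cprod : bmeas cprod.
Proof.
apply: bmeas_prod => i.
by apply: (bmeas_comp (bmeas_centered_ind tau p01)); exact: measurable_tnth.
Qed.

Definition scaled_axis (a : R) : 'I_s -> 'I_s -> R := axis_column (fun=> a).

Lemma tnth_scaled_axis a (w : s.-tuple R) i : tnth (lincomb (scaled_axis a) w) i = a * tnth w i.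
Proof.
rewrite tnth_mktuple (bigD1 i)//= /scaled_axis /axis_column eqxx mulr1 mulrC.
by rewrite big1 ?addr0// => j /negbTE ->; rewrite !mulr0.
Qed.

(** Given u, the coordinates of w are independent and the product of the integrals
    is expanded over the signs. *)
Lemma norm_smoothed_prod_le (u : s.-tuple R) :
  `|\int[iid std_normal s]_w cprod (tadd (u, lincomb (scaled_axis (Num.sqrt (1 - eta))) w))| <=
  (4 * Num.sqrt eta) ^+ s * \sum_(th : {ffun 'I_s -> bool})
     expR (\sum_(i < s) (-1) ^+ th i / Num.sqrt eta * tnth u i).
Proof.
have -> : \int[iid std_normal s]_w cprod (tadd (u, lincomb (scaled_axis (Num.sqrt (1 - eta))) w)) =
    \prod_(i < s) \int[std_normal]_t centered_ind (tnth u i + Num.sqrt (1 - eta) * t).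
  rewrite -Rintegral_iid_prod.
    apply: eq_Rintegral => w _; apply: eq_bigr => i _.
    by rewrite tnth_tadd tnth_scaled_axis.
  move=> i; apply: (bmeas_comp (bmeas_centered_ind tau p01)).
  by apply: measurable_funD => //; exact: measurable_funM.
rewrite normr_prod.
apply: (@le_trans _ _ (\prod_(i < s) (4 * Num.sqrt eta *
    \sum_(b : bool) expR ((-1) ^+ b / Num.sqrt eta * tnth u i)))).
  apply: ler_prod => i _; rewrite normr_ge0 /=.
  exact: smoothed_indicator_le2.
rewrite big_split /= prodr_const card_ord bigA_distr_bigA /=.
rewrite ler_wpM2l ?exprn_ge0 ?mulr_ge0 ?sqrtr_ge0//.
by apply: ler_sum => th _; rewrite expR_sum.
Qed.

Context (d : nat) (x : 'I_s -> d.-tuple R).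

Definition gram_err (i j : 'I_s) : R := dotp (x i) (x j) / d%:R - (i == j)%:R.
Hypothesis gram_row : forall i, \sum_(j < s) `|gram_err i j| <= eta.

Let Cx (j : 'I_d) (i : 'I_s) : R := (Num.sqrt d%:R)^-1 * tnth (x i) j.
Let noise := noise_columns gram_err eta.
Let a : R := Num.sqrt (1 - eta).

Let gram_err_sym i j : gram_err i j = gram_err j i.
Proof.
rewrite /gram_err eq_sym; congr (_ / _ - _).
by apply: eq_bigr => k _; rewrite mulrC.
Qed.

(** The splitting I + E = (eta I + E) + (1 - eta) I. *)
Let same_gram i j : gram [seq Cx k | k <- enum 'I_d] i j =
  gram (noise ++ [seq scaled_axis a k | k <- enum 'I_s]) i j.
Proof.
rewrite gram_cat gram_axis (gram_noise gram_err_sym gram_row).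
rewrite /gram big_map big_enum /= sqr_sqrtr ?subr_ge0; last by have := eta_le; lra.
transitivity (dotp (x i) (x j) / d%:R); last by rewrite /gram_err; ring.
rewrite /dotp mulr_suml; apply: eq_bigr => k _; rewrite /Cx mulrACA -invfM -expr2.
by rewrite sqr_sqrtr// mulrC.
Qed.

Let law_split (F : s.-tuple R -> \bar R) :
  measurable_fun setT F -> (forall v, 0 <= F v)%E ->
  (\int[iid std_normal d]_y F (lincomb Cx y) =
   \int[product_prob (glaw noise) (iid std_normal s)]_z F (tadd (z.1, lincomb (scaled_axis a) z.2)))%E.
Proof.
move=> mF F0.
have mz : measurable_fun setT (fun z : s.-tuple R * s.-tuple R =>
    (z.1, lincomb (scaled_axis a) z.2)).
  apply: measurable_fun_pair => //.
  exact: (measurableT_comp (measurable_lincomb (scaled_axis a)) measurable_snd).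
apply: (etrans (ge0_integral_lincomb Cx mF F0)).
apply: (etrans (laweq_gram same_gram mF F0)).
apply: (etrans (ge0_integral_glaw_cat _ _ mF F0)).
apply: (etrans _ (esym (fubini_tonelli1 (m1 := glaw noise) (m2 := iid std_normal s) _
   (measurableT_comp mF (measurableT_comp (@measurable_tadd R s) mz)) (fun=> F0 _)))).
apply: eq_integral => u _.
apply: (etrans (esym (ge0_integral_lincomb (scaled_axis a)
  (measurableT_comp mF (measurableT_comp (@measurable_tadd R s) (measurable_pair1 u)))
  (fun=> F0 _)))).
by [].
Qed.

(** The 2^s sign patterns th give linear forms <th, u> / sqrt eta of variance at
    most 2 s, because the entries of eta I + E sum to at most 2 s eta in absolute
    value; each exponential moment is thus at most e^s. *)
Theorem conditional_bound :
  `|\int[iid std_normal d]_y \prod_(i < s) (edge_indicator tau (x i) y - p)| <=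
  (8 * expR 1 * Num.sqrt eta) ^+ s.
Proof.
have mz : measurable_fun setT (fun z : s.-tuple R * s.-tuple R =>
    tadd (z.1, lincomb (scaled_axis a) z.2)).
  apply: (measurableT_comp (@measurable_tadd R s)); apply: measurable_fun_pair => //.
  exact: (measurableT_comp (measurable_lincomb (scaled_axis a)) measurable_snd).
have -> : \int[iid std_normal d]_y \prod_(i < s) (edge_indicator tau (x i) y - p) =
    \int[iid std_normal d]_y cprod (lincomb Cx y).
  apply: eq_Rintegral => y _; apply: eq_bigr => i _.
  rewrite /edge_indicator /centered_ind tnth_mktuple /dotp mulr_sumr.
  by congr ((_ <= _)%R%:R - _); apply: eq_bigr => j _; rewrite /Cx; ring.
rewrite (bmeas_eq_law (measurable_lincomb Cx) mz law_split bmeas_cprod).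
rewrite (bmeas_fubini _ _ (bmeas_comp bmeas_cprod mz)).
have bin : bmeas (fun u => \int[iid std_normal s]_w cprod (tadd (u, lincomb (scaled_axis a) w))).
  exact: (bmeas_Rintegral (glaw noise) (iid std_normal s) (bmeas_comp bmeas_cprod mz)).
have mexp (th : {ffun 'I_s -> bool}) : measurable_fun setT
    (fun u : s.-tuple R => expR (\sum_(i < s) (-1) ^+ th i / Num.sqrt eta * tnth u i)).
  exact: (measurable_expR_dot (fun i => (-1) ^+ th i / Num.sqrt eta)).
rewrite -lee_fin.
apply: (le_trans (bmeas_norm_le (glaw noise) bin _ norm_smoothed_prod_le)).
  by apply: measurable_funM => //; exact: measurable_sum.
have r0 : 0 < Num.sqrt eta by rewrite sqrtr_gt0.
have k0 : (0 <= ((4 * Num.sqrt eta) ^+ s)%:E)%E.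
  by rewrite lee_fin exprn_ge0// mulr_ge0// ltW.
under eq_integral do rewrite EFinM.
rewrite (@ge0_integralZl _ _ _ (glaw noise) _ measurableT _ _ _ _ k0); first last.
- by move=> u _; rewrite lee_fin sumr_ge0// => th _; exact: expR_ge0.
- by apply/measurable_EFinP; exact: measurable_sum.
under eq_integral do rewrite -sumEFin.
rewrite ge0_integral_sum//; last by move=> th; apply/measurable_EFinP; exact: mexp.
under eq_bigr => th _ do rewrite (glaw_mgf noise (fun i => (-1) ^+ th i / Num.sqrt eta)).
rewrite sumEFin -EFinM lee_fin.
have -> : (8 * expR 1 * Num.sqrt eta) ^+ s =
    (4 * Num.sqrt eta) ^+ s * (expR 1 ^+ s *+ (2 ^ s)%N) :> R.
  have -> : expR 1 ^+ s *+ (2 ^ s)%N = (expR 1 * 2) ^+ s :> R.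
    by rewrite exprMn -natrX mulr_natr.
  by rewrite -exprMn; congr (_ ^+ _); ring.
rewrite ler_wpM2l ?exprn_ge0 ?mulr_ge0 ?sqrtr_ge0//.
have -> : expR 1 ^+ s *+ (2 ^ s)%N = \sum_(th : {ffun 'I_s -> bool}) expR 1 ^+ s :> R.
  by rewrite sumr_const card_ffun card_bool card_ord.
apply: ler_sum => th _; rewrite -expRM_natl ler_expR mulr1.
rewrite ler_pdivrMr//.
apply: (le_trans (noise_form_le gram_err_sym gram_row (ltW eta_gt0) (lam := (Num.sqrt eta)^-1) _ _)).
- by rewrite invr_ge0 ltW.
- by move=> i; rewrite normrM normrX normrN1 expr1n mul1r ger0_norm// invr_ge0 ltW.
suff -> : (Num.sqrt eta)^-1 ^+ 2 * (eta *+ 2) = 2 by [].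
rewrite exprVn sqr_sqrtr; last exact: ltW.
by rewrite mulrnAr mulVf// gt_eqF.
Qed.

End conditional_bound.

(** * Exponential moments of the Gram matrix *)
Section gaussian_moments.
Context (R : realType).
Local Notation std_normal := (@std_normal R).

(** The squared form is 1 <= (1 - t) exp(t + t^2), which follows from
    exp q >= 1 + q for t <= 0 and from exp q >= (1 + q/2)^2 for t > 0. *)
Lemma inv_sqrt1B_le (t : R) : `|t| <= 4^-1 ->
  (Num.sqrt (1 - t))^-1 <= expR (t / 2 + t ^+ 2 / 2).
Proof.
rewrite ler_norml => /andP[t_ge t_le].
have t1 : 0 < 1 - t by lra.
have s0 : 0 < Num.sqrt (1 - t) by rewrite sqrtr_gt0.
rewrite -[leLHS]mul1r ler_pdivrMr//.
rewrite -(ler_pXn2r (n := 2))// ?nnegrE ?mulr_ge0 ?expR_ge0 ?sqrtr_ge0//.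
rewrite expr1n exprMn (sqr_sqrtr (ltW t1)) expr2 -expRD.
have -> : t / 2 + t ^+ 2 / 2 + (t / 2 + t ^+ 2 / 2) = t + t ^+ 2 by field.
have [t0|t0] := leP t 0.
  have t3 : t ^+ 3 <= 0 by rewrite exprS mulr_le0_ge0// sqr_ge0.
  apply: (@le_trans _ _ ((1 + (t + t ^+ 2)) * (1 - t))).
    have -> : (1 + (t + t ^+ 2)) * (1 - t) = 1 - t ^+ 3 by ring.
    by lra.
  by rewrite ler_pM2r// expR_ge1Dx.
have q0 : 0 <= (t + t ^+ 2) / 2 by rewrite divr_ge0// addr_ge0 ?sqr_ge0// ltW.
apply: (@le_trans _ _ ((1 + (t + t ^+ 2) / 2) ^+ 2 * (1 - t))).
  have -> : (1 + (t + t ^+ 2) / 2) ^+ 2 * (1 - t) =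
    1 + t ^+ 2 * (1 - t * (3 + t + t * t)) / 4 by field.
  rewrite lerDl divr_ge0// mulr_ge0 ?sqr_ge0//.
  have : t * t <= 4^-1 * 4^-1 by rewrite ler_pM// ltW.
  by have : 0 <= t * t by [exact: sqr_ge0 t]; nra.
rewrite ler_pM2r//.
have -> : expR (t + t ^+ 2) = expR ((t + t ^+ 2) / 2) ^+ 2.
  by rewrite -expRM_natl; congr expR; field.
by rewrite lerXn2r ?nnegrE ?expR_ge0 ?addr_ge0// expR_ge1Dx.
Qed.

(** Given x, the inner product is normal with variance |x|^2, so the inner integral
    is exp(m^2 |x|^2 / 2). *)
Lemma integral_expR_dotp_le (d : nat) (m : R) : m ^+ 2 <= 4^-1 ->
  (\int[iid std_normal d]_x \int[iid std_normal d]_y (expR (m * dotp x y))%:E <=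
   (expR (d%:R * m ^+ 2))%:E)%E.
Proof.
move=> m_le.
have inner (x : d.-tuple R) : (\int[iid std_normal d]_y (expR (m * dotp x y))%:E =
    (\prod_(i < d) expR (m ^+ 2 / 2 * tnth x i ^+ 2))%:E)%E.
  have := @ge0_integral_iid_prod _ _ _ std_normal d
    (fun i t => expR (m * tnth x i * t)) (fun i => expR (m ^+ 2 / 2 * tnth x i ^+ 2)).
  move=> <-.
  - apply: eq_integral => y _; rewrite -expR_sum; congr (expR _)%:E.
    by rewrite /dotp mulr_sumr; apply: eq_bigr => i _; rewrite mulrA.
  - by move=> i; apply: measurableT_comp => //; exact: measurable_funM.
  - by move=> i y; exact: expR_ge0.
  - by move=> i; rewrite std_normal_mgf; congr (expR _)%:E; field.
under eq_integral do rewrite inner.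
have mx : measurable_fun setT (fun x : R => expR (m ^+ 2 / 2 * x ^+ 2)).
  by apply: measurableT_comp => //; apply: measurable_funM => //; exact: measurable_funX.
rewrite (@ge0_integral_iid_prod _ _ _ std_normal d (fun _ x => expR (m ^+ 2 / 2 * x ^+ 2))
  (fun=> (Num.sqrt (1 - m ^+ 2))^-1)); first last.
- by move=> i; apply: std_normal_mgf_sqr; lra.
- by move=> i x; exact: expR_ge0.
- by move=> i.
rewrite lee_fin prodr_const card_ord expRM_natl.
rewrite lerXn2r ?nnegrE ?expR_ge0 ?invr_ge0 ?sqrtr_ge0//.
apply: (le_trans (inv_sqrt1B_le _)); first by rewrite ger0_norm ?sqr_ge0.
rewrite ler_expR; have := sqr_ge0 m; move: (m ^+ 2) m_le => t t_le t0.
by rewrite expr2; nra.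
Qed.

Lemma integral_expR_sqnorm_le (d : nat) (t : R) : `|t| <= 4^-1 ->
  (\int[iid std_normal d]_x (expR (t / 2 * (dotp x x - d%:R)))%:E <=
   (expR (d%:R * (t ^+ 2 / 2)))%:E)%E.
Proof.
move=> t_le; have t1 : t < 1 by move: t_le; rewrite ler_norml; lra.
have := @ge0_integral_iid_prod _ _ _ std_normal d
  (fun i x => expR (- (t / 2)) * expR (t / 2 * x ^+ 2))
  (fun i => expR (- (t / 2)) * (Num.sqrt (1 - t))^-1).
have mx : measurable_fun setT (fun x : R => expR (t / 2 * x ^+ 2)).
  by apply: measurableT_comp => //; apply: measurable_funM => //; exact: measurable_funX.
move=> prodE.
rewrite (_ : (\int[iid std_normal d]_x _)%E =
  (\prod_(i < d) (expR (- (t / 2)) * (Num.sqrt (1 - t))^-1))%:E); last first.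
  rewrite -prodE.
  - apply: eq_integral => x _; congr _%:E.
    rewrite big_split /= prodr_const card_ord -expR_sum -expRM_natl -expRD; congr expR.
    have -> : dotp x x = \sum_(i < d) tnth x i ^+ 2.
      by apply: eq_bigr => i _; rewrite expr2.
    by rewrite -mulr_sumr; ring.
  - by move=> i; exact: measurable_funM.
  - by move=> i x; rewrite mulr_ge0 ?expR_ge0.
  - move=> i; under eq_integral do rewrite EFinM.
    rewrite ge0_integralZl//; first by rewrite std_normal_mgf_sqr.
    exact/measurable_EFinP.
rewrite lee_fin prodr_const card_ord expRM_natl.
rewrite lerXn2r ?nnegrE ?expR_ge0 ?mulr_ge0 ?invr_ge0 ?sqrtr_ge0 ?expR_ge0//.
apply: (le_trans (ler_wpM2l (expR_ge0 _) (inv_sqrt1B_le t_le))).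
by rewrite -expRD addKr.
Qed.

End gaussian_moments.

Lemma ge0_integral_iid1 d (T : measurableType d) (R : realType)
    (mu : probability T R) (F : T -> \bar R) :
  measurable_fun setT F -> (forall x, 0 <= F x)%E ->
  (\int[iid mu 1]_t F (tnth t ord0) = \int[mu]_x F x)%E.
Proof.
move=> mF F0.
have mF1 : measurable_fun setT (fun t : 1.-tuple T => F (tnth t ord0)).
  exact: (measurableT_comp mF (measurable_tnth ord0)).
apply: (etrans (ge0_integral_iidS _ mF1 (fun=> F0 _))).
apply: eq_integral => x _; rewrite integral_dirac//.
  by rewrite diracT mul1e tnth0.
by under eq_fun do rewrite tnth0; exact: measurable_cst.
Qed.

(** * Subfamilies of the latent vectors *)
Section family_law.
Context (R : realType) (dO : measure_display) (Omega : measurableType dO).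
Context (P : probability Omega R) (dT : measure_display) (T : measurableType dT).
Context (I : finType) (X : I -> {RV P >-> T}) (mu : probability T R).
Hypothesis X_law : forall u A, measurable A -> P (X u @^-1` A) = mu A.
Hypothesis X_indep : independent_RVs X.

Definition subfamily k (sigma : 'I_k -> I) (w : Omega) : k.-tuple T :=
  [tuple X (sigma i) w | i < k].

Lemma measurable_subfamily k (sigma : 'I_k -> I) :
  measurable_fun setT (subfamily sigma).
Proof.
apply/measurable_fun_tnthP => i.
rewrite (_ : _ \o _ = X (sigma i)); first exact: measurable_funP.
by apply/funext => w /=; rewrite tnth_mktuple.
Qed.

(** The product rule over the image of sigma gives the law of the subfamily on
    boxes. *)
Lemma ge0_integral_subfamily k (sigma : 'I_k -> I) (F : k.-tuple T -> \bar R) :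
  injective sigma -> measurable_fun setT F -> (forall t, 0 <= F t)%E ->
  (\int[P]_w F (subfamily sigma w) = \int[iid mu k]_t F t)%E.
Proof.
move=> inj_sigma mF F0.
pose Y : {mfun Omega >-> k.-tuple T} := HB.pack (subfamily sigma)
  (isMeasurableFun.Build _ _ _ _ _ (measurable_subfamily sigma)).
apply: (etrans (esym (ge0_integral_distribution (P := P) Y mF F0))).
apply: eq_measure_integral => B mB _; apply: iid_unique => // A mA.
pose A' u := if [pick i | sigma i == u] is Some i then A i else setT.
have A'E i : A' (sigma i) = A i.
  rewrite /A'; case: pickP => [j /eqP /inj_sigma -> //|/(_ i)].
  by rewrite eqxx.
have mA' u : measurable (A' u) by rewrite /A'; case: pickP.
pose J := [set sigma i | i : 'I_k]%SET.
have := X_indep J mA'.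
rewrite (big_imset _ (in2W inj_sigma)) /=.
under eq_bigr do rewrite A'E X_law//.
move=> <-; congr (P _); apply/seteqP; split=> w /=.
  move=> Aw u /=; rewrite /J => /imsetP[i _ ->] /=; rewrite A'E.
  by have := Aw i; rewrite tnth_mktuple.
move=> Aw i; rewrite tnth_mktuple -A'E; apply: Aw => /=.
by apply/imsetP; exists i.
Qed.

Lemma Rintegral_subfamily k (sigma : 'I_k -> I) (F : k.-tuple T -> R) :
  injective sigma -> bmeas F ->
  \int[P]_w F (subfamily sigma w) = \int[iid mu k]_t F t.
Proof.
move=> inj_sigma bF.
apply: (bmeas_eq_law (f2 := idfun) (measurable_subfamily sigma)) => //.
  exact: measurable_id.
by move=> G mG G0; exact: ge0_integral_subfamily.
Qed.

Lemma ge0_integral_member (u : I) (F : T -> \bar R) :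
  measurable_fun setT F -> (forall x, 0 <= F x)%E ->
  (\int[P]_w F (X u w) = \int[mu]_x F x)%E.
Proof.
move=> mF F0.
have mF1 : measurable_fun setT (fun t : 1.-tuple T => F (tnth t ord0)).
  exact: (measurableT_comp mF (measurable_tnth ord0)).
have inj1 : injective (fun _ : 'I_1 => u) by move=> i j _; rewrite !ord1.
have := ge0_integral_subfamily inj1 mF1 (fun=> F0 _).
under eq_integral do rewrite tnth_mktuple.
by move=> ->; exact: ge0_integral_iid1.
Qed.

Lemma ge0_integral_pair (u v : I) (F : T * T -> \bar R) : u != v ->
  measurable_fun setT F -> (forall x, 0 <= F x)%E ->
  (\int[P]_w F (X u w, X v w) = \int[mu]_x \int[mu]_y F (x, y))%E.
Proof.
move=> uv mF F0.
pose sigma (i : 'I_2) := if i == ord0 then u else v.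
have mF2 : measurable_fun setT (fun t : 2.-tuple T => F (tnth t ord0, tnth t ord_max)).
  by apply: (measurableT_comp mF); apply: measurable_fun_pair; exact: measurable_tnth.
have inj2 : injective sigma.
  move=> i j; rewrite /sigma; case: (unliftP ord0 i) => [i' ->|->];
    case: (unliftP ord0 j) => [j' ->|->] //=; rewrite ?ord1//.
    by move=> vu; rewrite vu eqxx in uv.
  by move=> vu; rewrite vu eqxx in uv.
have := ge0_integral_subfamily inj2 mF2 (fun=> F0 _).
under eq_integral do rewrite !tnth_mktuple.
move=> ->; apply: (etrans (ge0_integral_iidS _ mF2 (fun=> F0 _))).
apply: eq_integral => x _.
have mFx : measurable_fun setT (fun y => F (x, y)).
  exact: (measurableT_comp mF (measurable_pair1 x)).
apply: (etrans _ (ge0_integral_iid1 mu mFx (fun=> F0 _))).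
apply: eq_integral => t _; rewrite tnth0; congr (F (_, _)).
by rewrite (_ : ord_max = lift ord0 ord0) ?tnthS//; exact: val_inj.
Qed.

End family_law.

Lemma std_gaussian_iid (R : realType) (dO : measure_display)
    (Omega : measurableType dO) (P : probability Omega R) d
    (Y : {RV P >-> d.-tuple R}) (A : set (d.-tuple R)) :
  std_gaussian_law (distribution P Y) -> measurable A ->
  P (Y @^-1` A) = iid (@std_normal R) d A.
Proof. by move=> Ylaw mA; exact: (iid_unique (mu := @std_normal R) Ylaw). Qed.

Lemma measurable_dotp (R : realType) d :
  measurable_fun setT (fun z : d.-tuple R * d.-tuple R => dotp z.1 z.2).
Proof.
apply: measurable_sum => i; apply: measurable_funM;
  exact: (measurableT_comp (measurable_tnth i)).
Qed.

Lemma expR_half_le2 (R : realType) : expR (1 / 2) <= 2 :> R.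
Proof.
have := expR_ge1Dx (- (1 / 2) : R); rewrite expRN.
have := expR_gt0 (1 / 2 : R); move: (expR _) => e e0.
by rewrite -(ler_pM2r e0) mulVf ?gt_eqF//; lra.
Qed.

Section gram_moments.
Context (R : realType) (dO : measure_display) (Omega : measurableType dO).
Context (P : probability Omega R) (d : nat) (I : finType).
Context (X : I -> {RV P >-> d.-tuple R}).
Hypothesis X_law : forall u, std_gaussian_law (distribution P (X u)).
Hypothesis X_indep : independent_RVs X.
Hypothesis d_gt0 : (0 < d)%N.

Let X_iid u A (mA : measurable A) := std_gaussian_iid (X_law u) mA.

(** The deviation of a Gram matrix entry from the identity, b telling whether the
    two vertices are equal. *)
Definition vertex_err (x y : d.-tuple R) (b : bool) : R := dotp x y / d%:R - b%:R.

Lemma measurable_vertex_err b :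
  measurable_fun setT (fun z : d.-tuple R * d.-tuple R => vertex_err z.1 z.2 b).
Proof. by apply: measurable_funB => //; apply: measurable_funM => //; exact: measurable_dotp. Qed.

Lemma expR_norm_le (z : R) : expR `|z| <= expR z + expR (- z).
Proof.
have [z0|z0] := leP 0 z; first by rewrite ger0_norm// lerDl expR_ge0.
by rewrite ltr0_norm// lerDr expR_ge0.
Qed.

(** The condition on l^2 is the rate sqrt(k d) / 2 of either sign; k <= d / 16 keeps
    it in the range where the moments of products of normals are bounded. *)
Let gram_mgf_signed (u v : I) (l k : R) : 0 <= k -> k <= d%:R / 16 ->
  l ^+ 2 = k * d%:R / 4 ->
  (\int[P]_w (expR (l * vertex_err (X u w) (X v w) (u == v)))%:E <=
   (expR (k / 2))%:E)%E.
Proof.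
move=> k0 kd l2.
have d0 : 0 < d%:R :> R by rewrite ltr0n.
have mE b : measurable_fun setT (fun z : d.-tuple R * d.-tuple R =>
    (expR (l * vertex_err z.1 z.2 b))%:E).
  apply/measurable_EFinP; apply: measurableT_comp => //.
  by apply: measurable_funM => //; exact: measurable_vertex_err.
have [<-|uv] := eqVneq u v.
  have mEd : measurable_fun setT (fun x : d.-tuple R => (expR (l * vertex_err x x true))%:E).
    exact: (measurableT_comp (mE true) (measurable_fun_pair
      (@measurable_id _ (d.-tuple R) setT) (@measurable_id _ (d.-tuple R) setT))).
  rewrite (ge0_integral_member X_iid X_indep u mEd); last first.
    by move=> x; rewrite lee_fin expR_ge0.
  pose t := 2 * l / d%:R.
  have t_le : `|t| <= 4^-1.
    have : t ^+ 2 <= 4^-1 ^+ 2.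
      rewrite /t expr_div_n exprMn l2 ler_pdivrMr ?exprn_gt0//.
      by rewrite (expr2 d%:R); nra.
    rewrite -[t ^+ 2]real_normK ?num_real//.
    by have := normr_ge0 t; move: `|t| => a a0 a2; nra.
  apply: le_trans (le_trans (integral_expR_sqnorm_le d t_le) _).
    rewrite le_eqVlt; apply/orP; left; apply/eqP; apply: eq_integral => x _.
    by congr (expR _)%:E; rewrite /vertex_err /t /=; field; rewrite gt_eqF.
  rewrite lee_fin ler_expR /t expr_div_n exprMn l2.
  by rewrite le_eqVlt; apply/orP; left; apply/eqP; field; rewrite gt_eqF.
rewrite (ge0_integral_pair X_iid X_indep uv (mE false)); last first.
  by move=> x; rewrite lee_fin expR_ge0.
pose m := l / d%:R.
have m2 : m ^+ 2 = k / d%:R / 4.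
  by rewrite /m expr_div_n l2; field; rewrite gt_eqF.
have m_le : m ^+ 2 <= 4^-1.
  rewrite m2 ler_pdivrMr// ler_pdivrMr//; nra.
apply: le_trans (le_trans (integral_expR_dotp_le d m_le) _).
  rewrite le_eqVlt; apply/orP; left; apply/eqP.
  apply: eq_integral => x _; apply: eq_integral => y _.
  by congr (expR _)%:E; rewrite /vertex_err /m /=; field; rewrite gt_eqF.
rewrite lee_fin ler_expR m2.
have -> : d%:R * (k / d%:R / 4) = k / 4 by field; rewrite gt_eqF.
by lra.
Qed.

Lemma gram_mgf (u v : I) (k : R) : 0 <= k -> k <= d%:R / 16 ->
  (\int[P]_w (expR (Num.sqrt (k * d%:R) / 2 * `|vertex_err (X u w) (X v w) (u == v)|))%:E <=
   (2 * expR (k / 2))%:E)%E.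
Proof.
move=> k0 kd; set l := Num.sqrt (k * d%:R) / 2.
have l2 : l ^+ 2 = k * d%:R / 4.
  by rewrite expr_div_n sqr_sqrtr ?mulr_ge0//; congr (_ / _); ring.
have l0 : 0 <= l by rewrite divr_ge0 ?sqrtr_ge0.
have l2N : (- l) ^+ 2 = k * d%:R / 4 by rewrite sqrrN.
have mV : measurable_fun setT (fun w => vertex_err (X u w) (X v w) (u == v)).
  have mXX : measurable_fun setT (fun w => (X u w, X v w)).
    by apply: measurable_fun_pair; exact: measurable_funP.
  exact: (measurableT_comp (measurable_vertex_err (u == v)) mXX).
have mE (c : R) : measurable_fun setT
    (fun w => (expR (c * vertex_err (X u w) (X v w) (u == v)))%:E).
  by apply/measurable_EFinP; apply: measurableT_comp => //; exact: measurable_funM.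
apply: (@le_trans _ _ (\int[P]_w ((expR (l * vertex_err (X u w) (X v w) (u == v)))%:E +
    (expR (- l * vertex_err (X u w) (X v w) (u == v)))%:E))%E).
  apply: ge0_le_integral => //.
  - apply/measurable_EFinP; apply: measurableT_comp => //; apply: measurable_funM => //.
    exact: measurableT_comp.
  - exact: emeasurable_funD.
  - move=> w _; rewrite -EFinD lee_fin -{1}(ger0_norm l0) -normrM mulNr.
    exact: expR_norm_le.
rewrite ge0_integralD//.
by rewrite mulr2n mulrDl mul1r EFinD leeD// gram_mgf_signed.
Qed.

End gram_moments.

(** * The threshold *)
Section threshold.
Context (R : realType) (d : nat) (tau p : R).
Hypotheses (p01 : 0 <= p <= 1) (d_gt0 : (0 < d)%N).
Local Notation std_normal := (@std_normal R).
Local Notation centered_ind := (@centered_ind R tau p).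

Let d0 : 0 < d%:R :> R. Proof. by rewrite ltr0n. Qed.

Let measurable_scaled_dotp : measurable_fun setT
  (fun z : d.-tuple R * d.-tuple R => (Num.sqrt d%:R)^-1 * dotp z.1 z.2).
Proof. by apply: measurable_funM => //; exact: measurable_dotp. Qed.

(** The conditional mean of sigma - p on an edge, given one endpoint x. *)
Definition mean_edge (x : d.-tuple R) : R :=
  \int[iid std_normal d]_y centered_ind ((Num.sqrt d%:R)^-1 * dotp x y).

Let bmeas_edge : bmeas (fun z : d.-tuple R * d.-tuple R =>
  centered_ind ((Num.sqrt d%:R)^-1 * dotp z.1 z.2)).
Proof. exact: (bmeas_comp (bmeas_centered_ind tau p01) measurable_scaled_dotp). Qed.

Lemma mean_edge_gt0 (x : d.-tuple R) : 0 < dotp x x ->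
  mean_edge x = Phi (tau / Num.sqrt (dotp x x / d%:R)) - p.
Proof.
move=> x0; set r := Num.sqrt (dotp x x / d%:R).
have r0 : 0 < r by rewrite sqrtr_gt0 divr_gt0.
have r2 : r * r = dotp x x / d%:R by rewrite -expr2 sqr_sqrtr// ltW// divr_gt0.
pose C (j : 'I_d) (_ : 'I_1) : R := (Num.sqrt d%:R)^-1 * tnth x j.
have gramE i j : gram [seq C k | k <- enum 'I_d] i j = gram [:: fun=> r] i j.
  rewrite /gram big_map big_enum /= big_seq1 r2 /dotp mulr_suml.
  by apply: eq_bigr => k _; rewrite /C mulrACA -invfM -expr2 sqr_sqrtr// mulrC.
have mf2 : measurable_fun setT (fun t : R => axpy (fun=> r) (t, tuple0 R 1)).
  exact: (measurableT_comp (measurable_axpy _) (measurable_pair2 _)).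
have law (F : 1.-tuple R -> \bar R) : measurable_fun setT F -> (forall v, 0 <= F v)%E ->
    (\int[iid std_normal d]_y F (lincomb C y) =
     \int[std_normal]_t F (axpy (fun=> r) (t, tuple0 R 1)))%E.
  move=> mF F0; apply: (etrans (ge0_integral_lincomb C mF F0)).
  apply: (etrans (laweq_gram gramE mF F0)).
  apply: (etrans (ge0_integral_glaw_cons _ _ mF F0)).
  apply: eq_integral => t _; apply: ge0_integral_glaw_nil.
  exact: (measurableT_comp mF (measurableT_comp (measurable_axpy _) (measurable_pair1 t))).
have bF : bmeas (fun v : 1.-tuple R => centered_ind (tnth v ord0)).
  exact: (bmeas_comp (bmeas_centered_ind tau p01) (measurable_tnth ord0)).
have := bmeas_eq_law (measurable_lincomb C) mf2 law bF.
have <- : mean_edge x = \int[iid std_normal d]_y centered_ind (tnth (lincomb C y) ord0).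
  apply: eq_Rintegral => y _; rewrite tnth_mktuple /dotp mulr_sumr; congr centered_ind.
  by apply: eq_bigr => j _; rewrite /C; ring.
move=> ->.
have := Rintegral_centered_ind_affine tau p 0 r0; rewrite subr0 => <-.
by apply: eq_Rintegral => t _; rewrite tnth_axpy /= tnth_mktuple add0r addr0 mulrC.
Qed.

(** Given x, the threshold of a standard normal is tau / r with r = |x| / sqrt d,
    and |r - 1| <= |r^2 - 1|.  When r is far from 1 the bound is trivial, which
    covers x = 0. *)
Lemma mean_edge_err (x : d.-tuple R) :
  `|(Phi tau - p) - mean_edge x| <= 2 * `|vertex_err x x true|.
Proof.
have dx0 : 0 <= dotp x x by apply: sumr_ge0 => i _; rewrite -expr2 sqr_ge0.
have Phi01 b : 0 <= @Phi R b <= 1 by exact: Phi_ge0_le1.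
set e := vertex_err x x true.
have mean_edge01 : - p <= mean_edge x <= 1 - p.
  have bx : bmeas (fun y => centered_ind ((Num.sqrt d%:R)^-1 * dotp x y)).
    exact: (bmeas_section x bmeas_edge).
  have bcst r := bmeas_integrable (iid std_normal d) (bmeas_cst (d.-tuple R) r).
  have bint := bmeas_integrable (iid std_normal d) bx.
  apply/andP; split.
    have := le_Rintegral measurableT (bcst (- p)) bint _.
    rewrite Rintegral_prob_cst; apply => y _.
    by rewrite /centered_ind lerBrDr addrC subrr ler0n.
  have := le_Rintegral measurableT bint (bcst (1 - p)) _.
  rewrite Rintegral_prob_cst; apply => y _.
  by rewrite /centered_ind lerD2r lern1 leq_b1.
have [e_big|e_small] := leP (2^-1) `|e|.
  have := Phi01 tau; move: mean_edge01 => /andP[s1 s2] /andP[f1 f2].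
  by rewrite ler_norml; apply/andP; split; lra.
have eE : dotp x x / d%:R = 1 + e by rewrite /e /vertex_err addrC subrK.
have [e1 e2] : - 2^-1 < e /\ e < 2^-1 by apply/andP; rewrite -ltr_norml.
have x0 : 0 < dotp x x.
  have : 0 < dotp x x / d%:R by rewrite eE; lra.
  by rewrite pmulr_lgt0// invr_gt0.
rewrite mean_edge_gt0// opprB addrA subrK eE.
set r := Num.sqrt (1 + e).
have r0 : 0 < r by rewrite sqrtr_gt0; lra.
have r2 : r ^+ 2 = 1 + e by rewrite sqr_sqrtr//; lra.
have [r1|r1] := leP 1 r.
  have := Phi_scale (tau / r) r1; rewrite mulrC divfK ?gt_eqF// => h.
  apply: (le_trans h); have e0 : 0 <= e by nra.
  by rewrite ger0_norm//; nra.
have rV : 1 <= r^-1 by rewrite invf_ge1// ltW.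
have := Phi_scale tau rV; rewrite mulrC distrC => h.
apply: (le_trans h).
have e0 : e <= 0 by nra.
rewrite ler0_norm// -(ler_pM2r r0) mulrBl mulVf ?gt_eqF// mul1r.
have : 2^-1 <= r by nra.
nra.
Qed.


Context (dO : measure_display) (Omega : measurableType dO).
Context (P : probability Omega R) (I : finType).
Context (X : I -> {RV P >-> d.-tuple R}).
Hypothesis X_law : forall u, std_gaussian_law (distribution P (X u)).
Hypothesis X_indep : independent_RVs X.

Let X_iid u A (mA : measurable A) := std_gaussian_iid (X_law u) mA.

Lemma mean_edge_mean0 (u v : I) : u != v ->
  P [set w | (Num.sqrt d%:R)^-1 * dotp (X u w) (X v w) <= tau] = p%:E ->
  \int[iid std_normal d]_x mean_edge x = 0.
Proof.
move=> uv Pp.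
have mXX : measurable_fun setT (fun w => (X u w, X v w)).
  by apply: measurable_fun_pair; exact: measurable_funP.
have law (F : d.-tuple R * d.-tuple R -> \bar R) :
    measurable_fun setT F -> (forall z, 0 <= F z)%E ->
    (\int[P]_w F (X u w, X v w) = \int[product_prob (iid std_normal d) (iid std_normal d)]_z F z)%E.
  move=> mF F0; apply: (etrans (ge0_integral_pair X_iid X_indep uv mF F0)).
  exact: (esym (fubini_tonelli1 (m1 := iid std_normal d) (m2 := iid std_normal d) F mF F0)).
have := bmeas_fubini (iid std_normal d) (iid std_normal d) bmeas_edge; rewrite /= => <-.
rewrite -(bmeas_eq_law mXX (@measurable_id _ _ setT) law bmeas_edge).
pose A := [set w | (Num.sqrt d%:R)^-1 * dotp (X u w) (X v w) <= tau].
have mA : measurable A.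
  have := measurableT_comp measurable_scaled_dotp mXX.
  move=> /(_ measurableT `]-oo, tau]%classic (measurable_itv _)).
  by rewrite setTI; congr measurable; apply/seteqP; split=> w /=; rewrite in_itv.
have -> : \int[P]_w centered_ind ((Num.sqrt d%:R)^-1 * dotp (X u w) (X v w)) =
    \int[P]_w (\1_A w - p).
  apply: eq_Rintegral => w _; rewrite /centered_ind indicE.
  rewrite (_ : (w \in A) = ((Num.sqrt d%:R)^-1 * dotp (X u w) (X v w) <= tau))//.
  by apply/idP/idP => [/set_mem//|h]; apply/mem_set.
rewrite RintegralB//.
- rewrite Rintegral_prob_cst; apply/eqP; rewrite subr_eq0; apply/eqP.
  by rewrite /Rintegral integral_indic// setIT; exact: (congr1 fine Pp).
- apply: (bmeas_integrable P (f := \1_A)).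
  split; first exact: measurable_indic.
  by exists 1 => t; rewrite indicE; case: (_ \in _); rewrite ?normr1 ?normr0.
- by apply: bmeas_integrable; exact: bmeas_cst.
Qed.

(** The mean of [mean_edge] over x is 0, so Phi tau - p is the mean of the
    difference, bounded through |z| <= exp(l |z|) / l at the rate l = sqrt d / 2. *)
Lemma threshold_Phi (u v : I) : u != v -> (16 <= d)%N ->
  P [set w | (Num.sqrt d%:R)^-1 * dotp (X u w) (X v w) <= tau] = p%:E ->
  `|Phi tau - p| <= 16 / Num.sqrt d%:R.
Proof.
move=> uv d16 Pp.
have sd0 : 0 < Num.sqrt d%:R :> R by rewrite sqrtr_gt0.
pose l : R := Num.sqrt (1 * d%:R) / 2.
have l0 : 0 < l by rewrite divr_gt0// mul1r.
have b_mean_edge : bmeas mean_edge.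
  exact: (bmeas_Rintegral (iid std_normal d) (iid std_normal d) bmeas_edge).
have mV0 : measurable_fun setT (fun x : d.-tuple R => vertex_err x x true).
  exact: (measurableT_comp (measurable_vertex_err true) (measurable_fun_pair
    (@measurable_id _ (d.-tuple R) setT) (@measurable_id _ (d.-tuple R) setT))).
have mV : measurable_fun setT (fun x : d.-tuple R => expR (l * `|vertex_err x x true|)).
  apply: measurableT_comp => //; apply: measurable_funM => //.
  exact: measurableT_comp.
have err_le (x : d.-tuple R) : `|(Phi tau - p) - mean_edge x| <=
    2 / l * expR (l * `|vertex_err x x true|).
  apply: (le_trans (mean_edge_err x)); rewrite -mulrA ler_wpM2l//.
  rewrite ler_pdivlMl// (le_trans _ (expR_ge1Dx _))// lerDr//.
have bdiff : bmeas (fun x => (Phi tau - p) - mean_edge x).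
  by apply: bmeasB => //; exact: bmeas_cst.
have -> : Phi tau - p = \int[iid std_normal d]_x ((Phi tau - p) - mean_edge x).
  rewrite RintegralB//.
  - by rewrite (mean_edge_mean0 uv Pp) subr0; apply/esym/Rintegral_prob_cst.
  - by apply: bmeas_integrable; exact: bmeas_cst.
  - exact: bmeas_integrable.
rewrite -lee_fin.
apply: (le_trans (bmeas_norm_le (iid std_normal d) bdiff _ err_le)); first exact: measurable_funM.
under eq_integral do rewrite EFinM.
have k0 : (0 <= (2 / l)%:E)%E by rewrite lee_fin divr_ge0// ltW.
rewrite (@ge0_integralZl _ _ _ (iid std_normal d) _ measurableT _ _ _ _ k0); first last.
- by move=> x _; rewrite lee_fin expR_ge0.
- exact/measurable_EFinP.
have mVE : measurable_fun setT (fun x : d.-tuple R =>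
    (expR (l * `|vertex_err x x true|))%:E) by exact/measurable_EFinP.
rewrite -(ge0_integral_member X_iid X_indep u mVE); last first.
  by move=> x; rewrite lee_fin expR_ge0.
have k1 : (1 : R) <= d%:R / 16 by rewrite ler_pdivlMr// mul1r ler_nat.
have := gram_mgf X_law X_indep d_gt0 u u ler01 k1.
rewrite eqxx => mgf.
apply: (le_trans (lee_wpmul2l k0 mgf)).
rewrite -EFinM lee_fin.
have e_le := expR_half_le2 R.
have -> : 2 / l = 4 / Num.sqrt d%:R.
  by rewrite /l mul1r; field; rewrite gt_eqF.
rewrite mulrAC ler_pM2r ?invr_gt0//.
by rewrite (le_trans (_ : _ <= 4 * (2 * 2)))//; lra.
Qed.

End threshold.

(** * The product of the stars for fixed left vectors *)
Section deterministic_bound.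
Context (R : realType) (d m n : nat) (tau p : R).
Hypotheses (p01 : 0 <= p <= 1) (d_gt0 : (0 < d)%N).
Hypothesis sd_ge : 256 <= Num.sqrt d%:R :> R.
Hypothesis Phi_p : `|Phi tau - p| <= 16 / Num.sqrt d%:R.
Local Notation std_normal := (@std_normal R).
Local Notation gamma := (iid std_normal d).

Let d0 : 0 < d%:R :> R. Proof. by rewrite ltr0n. Qed.
Let sd0 : 0 < Num.sqrt d%:R :> R. Proof. by rewrite sqrtr_gt0. Qed.

Lemma bmeas_edge : bmeas (fun z : d.-tuple R * d.-tuple R =>
  edge_indicator tau z.1 z.2 - p).
Proof.
apply: (bmeas_comp (bmeas_centered_ind tau p01) (g := fun z : d.-tuple R * d.-tuple R =>
  (Num.sqrt d%:R)^-1 * dotp z.1 z.2)).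
by apply: measurable_funM => //; exact: measurable_dotp.
Qed.

Lemma edge_le1 (x y : d.-tuple R) : `|edge_indicator tau x y - p| <= 1.
Proof. exact: (centered_ind_le1 tau p01 ((Num.sqrt d%:R)^-1 * dotp x y)). Qed.

Definition star (N : {set 'I_m}) (xs : m.-tuple (d.-tuple R)) : R :=
  \int[gamma]_y \prod_(i in N) (edge_indicator tau (tnth xs i) y - p).

Lemma star_le1 (N : {set 'I_m}) (xs : m.-tuple (d.-tuple R)) : `|star N xs| <= 1.
Proof.
apply: le_Rintegral_cst.
  apply: bmeas_prod => i.
  exact: (bmeas_section (tnth xs i) bmeas_edge).
by move=> y; rewrite normr_prod; apply: prodr_ile1 => i _; rewrite normr_ge0 edge_le1.
Qed.

Lemma star_le (N : {set 'I_m}) (xs : m.-tuple (d.-tuple R)) (eta : R) : 0 < eta -> eta <= 2^-1 ->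
  `|Phi tau - p| <= Num.sqrt eta ->
  (forall i, i \in N ->
    \sum_(j in N) `|vertex_err (tnth xs i) (tnth xs j) (i == j)| <= eta) ->
  `|star N xs| <= (8 * expR 1 * Num.sqrt eta) ^+ #|N|.
Proof.
move=> eta0 eta_le Phi_eta row.
have := @conditional_bound R #|N| tau p eta p01 eta0 eta_le Phi_eta d
  (fun k => tnth xs (enum_val k)).
rewrite (_ : \int[gamma]_y _ = star N xs); last first.
  by apply: eq_Rintegral => y _; rewrite [RHS]big_enum_val.
apply => k; have := row _ (enum_valP k); rewrite big_enum_val.
apply: le_trans; rewrite le_eqVlt; apply/orP; left; apply/eqP.
apply: eq_bigr => l _; rewrite /gram_err /vertex_err.
by rewrite (inj_eq enum_val_inj).
Qed.

Variable alpha : {set 'I_m * 'I_n}.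
Let k := #|alpha|.
Hypothesis k_gt0 : (0 < k)%N.

Definition nbr (v : 'I_n) : {set 'I_m} := [set i | (i, v) \in alpha].
Definition left_vertices : {set 'I_m} := [set e.1 | e in alpha].

Lemma sum_card_nbr : (\sum_(v < n) #|nbr v|)%N = k.
Proof.
rewrite /k -sum1_card.
rewrite (eq_bigl (fun e => (e.1, e.2) \in alpha)); last by case.
rewrite -(pair_big_dep xpredT (fun i v => (i, v) \in alpha) (fun _ _ => 1%N)) /=.
rewrite (exchange_big_dep xpredT) //=; apply: eq_bigr => v _.
by rewrite -sum1_card; apply: eq_bigl => i; rewrite inE.
Qed.

Lemma nbr_sub v : nbr v \subset left_vertices.
Proof.
by apply/fintype.subsetP => i; rewrite inE => iv; apply/imsetP; exists (i, v).
Qed.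

Lemma card_left_vertices : (#|left_vertices| <= k)%N.
Proof. exact: leq_imset_card. Qed.

(** k^(3/2) / sqrt d, the order of magnitude of eta. *)
Definition scale : R := k%:R * Num.sqrt k%:R / Num.sqrt d%:R.
Definition rate : R := Num.sqrt (k%:R * d%:R) / 2.

(** With M the largest deviation between left vertices, eta = k M + 1 / sqrt d
    bounds the row sums in every star.  By 1 + z <= exp z it is at most
    scale * exp(M sqrt(d / k)), so (sqrt eta)^k is at most (sqrt scale)^k times the
    term of the sum at the pair where M is reached.  For eta > 1/2 the factors
    are simply bounded by 1. *)
Lemma stars_le (xs : m.-tuple (d.-tuple R)) :
  `|\prod_(v < n) star (nbr v) xs| <=
  (8 * expR 1 * Num.sqrt scale) ^+ k *
  \sum_(ij in finset.setX left_vertices left_vertices)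
    expR (rate * `|vertex_err (tnth xs ij.1) (tnth xs ij.2) (ij.1 == ij.2)|).
Proof.
set F := fun ij : 'I_m * 'I_m =>
  `|vertex_err (tnth xs ij.1) (tnth xs ij.2) (ij.1 == ij.2)|.
have k0 : 0 < k%:R :> R by rewrite ltr0n.
have k1 : 1 <= k%:R :> R by rewrite ler1n.
have sk0 : 0 < Num.sqrt k%:R :> R by rewrite sqrtr_gt0.
have skk : Num.sqrt k%:R ^+ 2 = k%:R :> R by rewrite sqr_sqrtr// ltW.
have sk1 : 1 <= Num.sqrt k%:R :> R by rewrite -[leLHS]sqrtr1 ler_sqrt.
have [e e_alpha] : exists e, e \in alpha by apply/card_gt0P.
have i0L : (e.1, e.1) \in finset.setX left_vertices left_vertices.
  by rewrite finset.in_setX /= andbb; apply: imset_f.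
have [ij ijL maxF] : exists2 ij, ij \in finset.setX left_vertices left_vertices &
    forall ij', ij' \in finset.setX left_vertices left_vertices -> F ij' <= F ij.
  by case: (arg_maxP F i0L) => ij ijL maxF; exists ij.
pose M := F ij.
have M0 : 0 <= M by exact: normr_ge0.
pose eta : R := k%:R * M + (Num.sqrt d%:R)^-1.
have eta0 : 0 < eta by rewrite ltr_wpDl ?mulr_ge0 ?invr_gt0// ltW.
have scale0 : 0 < scale by rewrite /scale divr_gt0// mulr_gt0.
have eta_scale : Num.sqrt eta <= Num.sqrt scale * expR (Num.sqrt d%:R / Num.sqrt k%:R * M / 2).
  rewrite -[leRHS]ger0_norm ?mulr_ge0 ?sqrtr_ge0 ?expR_ge0// -sqrtr_sqr ler_wsqrtr//.
  rewrite exprMn (sqr_sqrtr (ltW scale0)) -expRM_natl.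
  have -> : 2%:R * (Num.sqrt d%:R / Num.sqrt k%:R * M / 2) =
    Num.sqrt d%:R / Num.sqrt k%:R * M :> R by field; rewrite gt_eqF.
  apply: (@le_trans _ _ (scale * (1 + Num.sqrt d%:R / Num.sqrt k%:R * M))); last first.
    by rewrite ler_pM2l// expR_ge1Dx.
  have -> : scale * (1 + Num.sqrt d%:R / Num.sqrt k%:R * M) = k%:R * M + scale.
    by rewrite /scale; field; rewrite !gt_eqF.
  rewrite /eta lerD2l /scale -[leLHS]mul1r ler_pM2r ?invr_gt0//.
  by rewrite -[leLHS]mulr1 ler_pM.
have prod_le : `|\prod_(v < n) star (nbr v) xs| <= (8 * expR 1 * Num.sqrt eta) ^+ k.
  have e2 : 2 <= expR 1 :> R by rewrite (le_trans _ (expR_ge1Dx _)).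
  rewrite normr_prod.
  have [eta_le|eta_big] := leP eta 2^-1; last first.
    apply: (@le_trans _ _ 1).
      by apply: prodr_ile1 => v _; rewrite normr_ge0 star_le1.
    apply: exprn_ege1.
    have : 2^-1 <= Num.sqrt eta.
      rewrite -(ler_pXn2r (n := 2)) ?nnegrE ?sqrtr_ge0// sqr_sqrtr; last exact: ltW.
      by lra.
    by nra.
  rewrite -sum_card_nbr -prodrXr; apply: ler_prod => v _.
  rewrite normr_ge0 /=; apply: star_le => //.
    apply: (le_trans Phi_p).
    rewrite -[leLHS]ger0_norm ?divr_ge0// -sqrtr_sqr ler_wsqrtr// expr_div_n.
    apply: (@le_trans _ _ (Num.sqrt d%:R)^-1); last by rewrite lerDr mulr_ge0// ltW.
    rewrite ler_pdivrMr ?exprn_gt0// (expr2 (Num.sqrt d%:R)) mulKf ?gt_eqF//.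
    by rewrite (le_trans _ sd_ge)//; lra.
  move=> i iN.
  apply: (@le_trans _ _ (\sum_(j in nbr v) M)).
    apply: ler_sum => j jN; apply: (maxF (i, j)).
    by rewrite finset.in_setX /= !(fintype.subsetP (nbr_sub v)).
  rewrite sumr_const -mulr_natl.
  apply: (@le_trans _ _ (k%:R * M)); last by rewrite lerDl invr_ge0 sqrtr_ge0.
  rewrite ler_wpM2r// ler_nat.
  exact: leq_trans (subset_leq_card (nbr_sub v)) card_left_vertices.
apply: (le_trans prod_le).
rewrite exprMn [in leRHS]exprMn -mulrA ler_wpM2l ?exprn_ge0 ?mulr_ge0 ?expR_ge0//.
apply: (@le_trans _ _ (Num.sqrt scale ^+ k * expR (rate * M))).
  apply: (@le_trans _ _ ((Num.sqrt scale * expR (Num.sqrt d%:R / Num.sqrt k%:R * M / 2)) ^+ k)).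
    by rewrite lerXn2r ?nnegrE ?mulr_ge0 ?sqrtr_ge0 ?expR_ge0.
  rewrite exprMn -expRM_natl le_eqVlt; apply/orP; left; apply/eqP.
  congr (_ * expR _); rewrite /rate (sqrtrM _ (ltW k0)) -[X in X * (_ / _)]skk.
  by field; rewrite gt_eqF.
rewrite ler_wpM2l ?exprn_ge0 ?sqrtr_ge0// (bigD1 ij)//= lerDl.
by apply: sumr_ge0 => ij' _; exact: expR_ge0.
Qed.

End deterministic_bound.

Lemma independent_RVs_pair (R : realType) (dO : measure_display)
    (Omega : measurableType dO) (P : probability Omega R)
    (dT : measure_display) (T : measurableType dT) (I : finType)
    (X : I -> {RV P >-> T}) (u v : I) :
  independent_RVs X -> u != v -> independent_RV2 (X u) (X v).
Proof.
move=> X_indep uv A B mA mB.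
pose AB w := if w == u then A else B.
have mAB w : measurable (AB w) by rewrite /AB; case: ifP.
have ABu : AB u = A by rewrite /AB eqxx.
have ABv : AB v = B by rewrite /AB eq_sym (negbTE uv).
have := X_indep [set u; v]%SET AB mAB.
rewrite big_setU1 ?inE//= big_set1 ABu ABv => <-.
congr (P _); apply/seteqP; split=> w /=.
  by move=> [Aw Bw] i /=; rewrite !inE => /orP[]/eqP ->; rewrite ?ABu ?ABv.
move=> ABw; split.
  by have := ABw u; rewrite ABu; apply; rewrite /= !inE eqxx.
by have := ABw v; rewrite ABv; apply; rewrite /= !inE eqxx orbT.
Qed.

(** * The expected signed weight *)
Section expectation.
Context (R : realType) (d m n : nat) (tau p : R).
Hypothesis p01 : 0 <= p <= 1.
Context (dO : measure_display) (Omega : measurableType dO).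
Context (P : probability Omega R) (X : 'I_m + 'I_n -> {RV P >-> d.-tuple R}).
Hypothesis X_law : forall u, std_gaussian_law (distribution P (X u)).
Hypothesis X_indep : independent_RVs X.
Variable alpha : {set 'I_m * 'I_n}.
Local Notation gamma := (iid (@std_normal R) d).

Let X_iid u A (mA : measurable A) := std_gaussian_iid (X_law u) mA.

Let weight (t : (m + n).-tuple (d.-tuple R)) : R :=
  signed_weight p tau alpha (fun u => tnth t (unsplit u)).

Let bmeas_weight : bmeas weight.
Proof.
apply: bmeas_prod => e.
exact: (bmeas_comp (bmeas_edge d tau p01)
  (measurable_fun_pair (measurable_tnth _) (measurable_tnth _))).
Qed.

Lemma signed_weight_le1 (x : 'I_m + 'I_n -> d.-tuple R) :
  `|signed_weight p tau alpha x| <= 1.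
Proof.
rewrite normr_prod; apply: prodr_ile1 => e _; rewrite normr_ge0 /=.
exact: edge_le1.
Qed.

Let weightE w : signed_weight p tau alpha (fun u => X u w) =
  weight (subfamily X (@fintype.split m n) w).
Proof. by apply: eq_bigr => e _; rewrite !tnth_mktuple !unsplitK. Qed.

Let split_inj : injective (@fintype.split m n).
Proof. exact: can_inj (@splitK m n). Qed.

Let bmeas_subweight : bmeas (fun w => signed_weight p tau alpha (fun u => X u w)).
Proof.
under eq_fun do rewrite weightE.
exact: (bmeas_comp bmeas_weight (measurable_subfamily X _)).
Qed.

Lemma expectation_weight_le1 :
  ('E_P[fun w => signed_weight p tau alpha (fun u => X u w)] <= 1%:E)%E.
Proof.
rewrite unlock -(bmeas_EFin_Rintegral P bmeas_subweight) lee_fin.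
rewrite (le_trans (ler_norm _))//; apply: (le_Rintegral_cst P bmeas_subweight).
by move=> w; exact: signed_weight_le1.
Qed.

Let stars (xs : m.-tuple (d.-tuple R)) : R := \prod_(v < n) star tau p (nbr alpha v) xs.

Let measurable_tnth2 (i : 'I_m) : measurable_fun setT
  (fun z : m.-tuple (d.-tuple R) * d.-tuple R => (tnth z.1 i, z.2)).
Proof.
apply: measurable_fun_pair => //.
exact: (measurableT_comp (measurable_tnth i)).
Qed.

Let bmeas_stars : bmeas stars.
Proof.
apply: bmeas_prod => v.
apply: (bmeas_Rintegral (iid gamma m) gamma (f := fun z =>
  \prod_(i in nbr alpha v) (edge_indicator tau (tnth z.1 i) z.2 - p))).
apply: bmeas_prod => i.
exact: (bmeas_comp (bmeas_edge d tau p01) (measurable_tnth2 i)).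
Qed.

(** The right vectors are integrated first, and their integrals factor. *)
Lemma expectation_weight_stars :
  ('E_P[fun w => signed_weight p tau alpha (fun u => X u w)] =
   (\int[P]_w stars (subfamily X (@inl 'I_m 'I_n) w))%:E)%E.
Proof.
rewrite unlock -(bmeas_EFin_Rintegral P bmeas_subweight); congr _%:E.
under eq_Rintegral do rewrite weightE.
rewrite (Rintegral_subfamily X_iid X_indep split_inj bmeas_weight).
rewrite (Rintegral_iid_cat gamma bmeas_weight).
rewrite (Rintegral_subfamily X_iid X_indep (F := stars))//; last by move=> i j [].
apply: eq_Rintegral => s _.
transitivity (\int[iid gamma n]_t \prod_(v < n)
    \prod_(i in nbr alpha v) (edge_indicator tau (tnth s i) (tnth t v) - p)).
  apply: eq_Rintegral => t _; rewrite /weight /signed_weight.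
  under eq_bigr => e _.
    rewrite (_ : tnth _ (unsplit (inl e.1)) = tnth s e.1); last exact: tnth_lshift.
    rewrite (_ : tnth _ (unsplit (inr e.2)) = tnth t e.2); last exact: tnth_rshift.
    over.
  rewrite (eq_bigl (fun e => (e.1, e.2) \in alpha)); last by case.
  rewrite -(pair_big_dep xpredT (fun i v => (i, v) \in alpha)
    (fun i v => edge_indicator tau (tnth s i) (tnth t v) - p)) /=.
  rewrite (exchange_big_dep xpredT) //=; apply: eq_bigr => v _.
  by apply: eq_bigl => i; rewrite inE.
apply: (Rintegral_iid_prod gamma (f := fun v y =>
  \prod_(i in nbr alpha v) (edge_indicator tau (tnth s i) y - p))) => v.
by apply: bmeas_prod => i; exact: (bmeas_section (tnth s i) (bmeas_edge d tau p01)).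
Qed.

Hypothesis d_gt0 : (0 < d)%N.
Hypothesis sd_ge : 256 <= Num.sqrt d%:R :> R.
Hypothesis Phi_p : `|Phi tau - p| <= 16 / Num.sqrt d%:R.
Let k := #|alpha|.
Hypothesis k_gt0 : (0 < k)%N.
Hypothesis k_le : k%:R <= d%:R / 16 :> R.

Lemma expectation_weight_le :
  ('E_P[fun w => signed_weight p tau alpha (fun u => X u w)] <=
   ((8 * expR 1 * Num.sqrt (scale R d alpha)) ^+ k *
     (k%:R ^+ 2 * (2 * expR (k%:R / 2))))%:E)%E.
Proof.
rewrite expectation_weight_stars.
set c := (8 * _ * _) ^+ k.
have c0 : (0 <= c%:E)%E.
  by rewrite lee_fin exprn_ge0 ?mulr_ge0 ?expR_ge0 ?sqrtr_ge0.
pose L := left_vertices alpha.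
pose e (ij : 'I_m * 'I_m) w : R := expR (rate R d alpha *
  `|vertex_err (X (inl ij.1) w) (X (inl ij.2) w)
      ((inl ij.1 : 'I_m + 'I_n) == inl ij.2)|).
have me ij : measurable_fun setT (e ij).
  apply: measurableT_comp => //; apply: measurable_funM => //.
  apply: measurableT_comp => //.
  have mXX : measurable_fun setT (fun w => (X (inl ij.1) w, X (inl ij.2) w)).
    by apply: measurable_fun_pair; exact: measurable_funP.
  exact: (measurableT_comp (measurable_vertex_err _) mXX).
have stars_e w : `|stars (subfamily X (@inl 'I_m 'I_n) w)| <=
    c * \sum_(ij in finset.setX L L) e ij w.
  apply: (le_trans (stars_le p01 d_gt0 sd_ge Phi_p k_gt0 _)).
  rewrite le_eqVlt; apply/orP; left; apply/eqP; congr (_ * _).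
  by apply: eq_bigr => ij _; rewrite !tnth_mktuple.
rewrite EFinM.
apply: (@le_trans _ _ (`|\int[P]_w stars (subfamily X (@inl 'I_m 'I_n) w)|%:E)).
  by rewrite lee_fin ler_norm.
have bs := bmeas_comp bmeas_stars (measurable_subfamily X (@inl 'I_m 'I_n)).
have msum : measurable_fun setT (fun w => \sum_(ij in finset.setX L L) e ij w).
  rewrite (_ : (fun w => _) = fun w => \sum_(ij <- enum (finset.setX L L)) e ij w).
    exact: measurable_sum.
  by apply/funext => w; rewrite big_enum.
apply: (le_trans (bmeas_norm_le P bs (measurable_funM (measurable_cst c) msum) stars_e)).
under eq_integral do rewrite EFinM.
rewrite (@ge0_integralZl _ _ _ P _ measurableT _ _ _ _ c0); first last.
- by move=> w _; rewrite lee_fin sumr_ge0// => ij _; exact: expR_ge0.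
- exact/measurable_EFinP.
apply: lee_wpmul2l => //.
under eq_integral => w _ do rewrite -big_enum -sumEFin.
rewrite ge0_integral_sum; first last.
- by move=> ij w _; rewrite lee_fin expR_ge0.
- by move=> ij; apply/measurable_EFinP; exact: me.
- exact: measurableT.
have k0 : 0 <= k%:R :> R by [].
apply: (@le_trans _ _ (\sum_(ij <- enum (finset.setX L L)) (2 * expR (k%:R / 2))%:E)%E).
  apply: lee_sum => ij _.
  exact: (gram_mgf X_law X_indep d_gt0 (inl ij.1) (inl ij.2) k0 k_le).
rewrite sumEFin lee_fin big_enum sumr_const -[leLHS]mulr_natl ler_wpM2r ?mulr_ge0 ?expR_ge0//.
rewrite -natrX ler_nat cardsX expnS expn1.
by apply: leq_mul; exact: card_left_vertices.
Qed.

End expectation.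

(** * Constants *)
Section numerics.
Context (R : realType).

Lemma powR_half_natr (y : R) (k : nat) : 0 <= y -> y `^ (k%:R / 2) = Num.sqrt y ^+ k.
Proof.
move=> y0; rewrite mulrC powRrM powR12_sqrt// powR_mulrn// sqrtr_ge0.
Qed.

Lemma powR_3half (x : R) : 0 <= x -> x `^ (3 / 2) = x * Num.sqrt x.
Proof.
rewrite le_eqVlt => /orP[/eqP <-|x0].
  by rewrite powR0 ?mul0r// gt_eqF// divr_gt0.
have -> : 3 / 2 = 1 + 2^-1 :> R by field.
rewrite powRD; last by rewrite gt_eqF// implybT.
by rewrite powRr1 ?ltW// powR12_sqrt// ltW.
Qed.

Lemma sqrt_ln_ge (d : nat) : (2 <= d)%N -> 2^-1 <= Num.sqrt (ln d%:R) :> R.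
Proof.
move=> d2.
have ln2 : 4^-1 <= ln 2 :> R.
  rewrite -[leLHS]expRK ler_ln ?posrE ?expR_gt0//.
  apply: le_trans (expR_half_le2 R); rewrite ler_expR; lra.
have lnd : 4^-1 <= ln d%:R :> R.
  by rewrite (le_trans ln2)// ler_ln ?posrE ?ltr0n ?ler_nat// ltnW.
have -> : 2^-1 = Num.sqrt (4^-1) :> R.
  rewrite (_ : 4^-1 = 2^-1 ^+ 2 :> R); last by rewrite expr2 -invfM -natrM.
  by rewrite sqrtr_sqr ger0_norm.
exact: ler_wsqrtr.
Qed.

(** From k <= 2^k, 2 <= 2^k and exp(1/2) <= 2. *)
Lemma combinatorial_factor_le (k : nat) : (0 < k)%N ->
  k%:R ^+ 2 * (2 * expR (k%:R / 2)) <= 16 ^+ k :> R.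
Proof.
move=> k0.
have k2 : k%:R ^+ 2 <= 4 ^+ k :> R.
  have -> : 4 ^+ k = (2 ^+ k) ^+ 2 :> R by rewrite exprAC; congr (_ ^+ k); ring.
  rewrite lerXn2r ?nnegrE ?exprn_ge0// -natrX ler_nat.
  exact: ltnW (ltn_expl _ _).
have two : 2 <= 2 ^+ k :> R by rewrite -[leLHS]expr1 ler_eXn2l// ltr1n.
have ek : expR (k%:R / 2) <= 2 ^+ k :> R.
  have -> : k%:R / 2 = k%:R * (1 / 2) :> R by field.
  by rewrite expRM_natl lerXn2r ?nnegrE ?expR_ge0// expR_half_le2.
have -> : 16 ^+ k = 4 ^+ k * (2 ^+ k * 2 ^+ k) :> R.
  by rewrite -!exprMn; congr (_ ^+ _); ring.
by rewrite !ler_pM ?exprn_ge0 ?mulr_ge0 ?expR_ge0.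
Qed.

End numerics.

Theorem corollary2p3 (R : realType) (p : R) (hp0 : 0 < p) (hp1 : p < 1) :
  exists C : R, 0 < C /\
    forall (n m d : nat), (0 < n)%N -> (0 < m)%N -> (2 <= d)%N ->
    forall (tau : R), is_threshold d p tau ->
    forall (dO : measure_display) (Omega : measurableType dO)
      (P : probability Omega R)
      (X : 'I_m + 'I_n -> {RV P >-> d.-tuple R}),
      (forall u, std_gaussian_law (distribution P (X u))) ->
      independent_RVs X ->
    forall alpha : {set 'I_m * 'I_n},
      ('E_P[fun w => signed_weight p tau alpha (fun u => X u w)] <=
        ((C * #|alpha|%:R `^ (3 / 2) * ln d%:R `^ (1 / 2) / Num.sqrt d%:R)
           `^ (#|alpha|%:R / 2))%:E)%E.
Proof.
have p01 : 0 <= p <= 1 by rewrite !ltW.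
(* 128 e = 16 * 8 e: the 8 e of each edge and the 16^k of the number of pairs. *)
pose C1 : R := 128 * expR 1.
have e2 : 2 <= expR 1 :> R by rewrite (le_trans _ (expR_ge1Dx _)).
have C1_ge : 256 <= C1 by rewrite /C1; lra.
exists (2 * C1 ^+ 2); split; first by rewrite mulr_gt0// exprn_gt0//; lra.
move=> n m d n0 m0 d2 tau tau_thr dO Omega P X X_law X_indep alpha.
set k := #|alpha|; set b := _ / Num.sqrt d%:R.
have [k0|k_gt0] := posnP k.
  by rewrite k0 mul0r powRr0; exact: (expectation_weight_le1 tau p01 X alpha).
have d_gt0 : (0 < d)%N by exact: leq_trans d2.
have d0 : 0 < d%:R :> R by rewrite ltr0n.
have sd0 : 0 < Num.sqrt d%:R :> R by rewrite sqrtr_gt0.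
have bE : b = 2 * C1 ^+ 2 * Num.sqrt (ln d%:R) * (k%:R * Num.sqrt k%:R / Num.sqrt d%:R).
  have ln0 : 0 <= ln d%:R :> R by rewrite ln_ge0// ler1n.
  rewrite /b powR_3half// mul1r powR12_sqrt//; ring.
pose q : R := k%:R * Num.sqrt k%:R / Num.sqrt d%:R.
have q0 : 0 <= q by rewrite divr_ge0 ?mulr_ge0 ?sqrtr_ge0.
have ln_ge := sqrt_ln_ge R d2.
have C1q : C1 ^+ 2 * q <= b.
  have A0 : 0 <= C1 ^+ 2 * q by rewrite mulr_ge0// sqr_ge0.
  rewrite bE -/q; set s := Num.sqrt (ln d%:R).
  have -> : 2 * C1 ^+ 2 * s * q = 2 * s * (C1 ^+ 2 * q) by ring.
  by rewrite -[leLHS]mul1r ler_wpM2r// -ler_pdivrMl// mulr1.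
have b0 : 0 <= b by apply: le_trans C1q; rewrite mulr_ge0// sqr_ge0.
have kh0 : 0 <= k%:R / 2 :> R by rewrite divr_ge0.
(* If the claimed bound is at least 1 it is trivial; otherwise d is large. *)
have [b1|b1] := leP 1 b.
  apply: (le_trans (expectation_weight_le1 tau p01 X alpha)).
  rewrite lee_fin; apply: (@le_trans _ _ (1 `^ (k%:R / 2))); first by rewrite powR1.
  by rewrite ge0_ler_powR ?nnegrE.
have k1 : 1 <= k%:R :> R by rewrite ler1n.
have sk1 : 1 <= Num.sqrt k%:R :> R by rewrite -[leLHS]sqrtr1 ler_sqrt// ltr0n.
have sd_big : C1 ^+ 2 * (k%:R * Num.sqrt k%:R) <= Num.sqrt d%:R.
  by have := le_trans C1q (ltW b1); rewrite /q mulrA ler_pdivrMr// mul1r.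
have C1sq : 256 <= C1 ^+ 2 by rewrite expr2; nra.
have sd_sk : 256 * Num.sqrt k%:R <= Num.sqrt d%:R :> R.
  have sk0 : 0 <= Num.sqrt k%:R :> R by exact: sqrtr_ge0.
  apply: le_trans sd_big; apply: (@le_trans _ _ (C1 ^+ 2 * Num.sqrt k%:R)).
    exact: (ler_wpM2r sk0 C1sq).
  apply: ler_wpM2l; first exact: sqr_ge0.
  by rewrite -[leLHS]mul1r; exact: (ler_wpM2r sk0 k1).
have sd_ge : 256 <= Num.sqrt d%:R :> R by lra.
have k_le : k%:R <= d%:R / 16 :> R.
  rewrite ler_pdivlMr// -(sqr_sqrtr (ltW d0)) -{1}(sqr_sqrtr (ler0n R k)).
  by rewrite !expr2; nra.
have d16 : (16 <= d)%N.
  rewrite -(ler_nat R); move: k_le; rewrite ler_pdivlMr// => /(le_trans _); apply.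
  by rewrite -[leLHS]mul1r ler_wpM2r.
pose u : 'I_m + 'I_n := inl (Ordinal m0).
pose v : 'I_m + 'I_n := inr (Ordinal n0).
have uv : u != v by [].
have Pp := tau_thr dO Omega P (X u) (X v) (X_law u) (X_law v)
  (independent_RVs_pair X_indep uv).
have Phi_p := threshold_Phi p01 d_gt0 X_law X_indep uv d16 Pp.
apply: (le_trans (expectation_weight_le p01 X_law X_indep d_gt0 sd_ge Phi_p k_gt0 k_le)).
rewrite lee_fin.
have scaleE : scale R d alpha = q by [].
rewrite scaleE -/k.
apply: (@le_trans _ _ ((C1 ^+ 2 * q) `^ (k%:R / 2))); last first.
  by rewrite ge0_ler_powR ?nnegrE// mulr_ge0// sqr_ge0.
have C1q0 : 0 <= C1 ^+ 2 * q by rewrite mulr_ge0// sqr_ge0.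
rewrite (powR_half_natr k C1q0).
have -> : Num.sqrt (C1 ^+ 2 * q) = C1 * Num.sqrt q.
  by rewrite sqrtrM ?sqr_ge0// sqrtr_sqr ger0_norm//; lra.
have -> : (C1 * Num.sqrt q) ^+ k = (8 * expR 1 * Num.sqrt q) ^+ k * 16 ^+ k.
  by rewrite -exprMn; congr (_ ^+ _); rewrite /C1; ring.
rewrite ler_wpM2l ?combinatorial_factor_le//.
Qed.
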